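(* Let $1\le\kappa<\infty$ and let $(a(e);e\in\mathbb L^d)$ be i.i.d. random conductances on the edges of $\mathbb Z^d$ such that $0<a(e)\le\kappa$ for all edges $e$. Let $C_0=32d\kappa^3$ and let $f_N$ be the effective conductance between opposite faces of $Q_N=\{1,\dots,N\}^d$ (defined in the context). (i) If $d\ge 5$, then for all $N\ge1$, $\mathrm{Var}(f_N)\le 128 d\kappa^2N^{4-d}$, and for all $t>0$ and $N\ge 1$, $$\mathbb P\big(|f_N-\mathbb E f_N|\ge tN^{(4-d)/2}\big)\le 4\exp\big(-t/(8\kappa\sqrt{2d})\big).$$ (ii) Suppose moreover that for some constants $D_0<\infty$ and $\gamma$ with $0<\gamma<2$, $$\mathbb P(a^{-1}(e)\ge s)\le D_0\,s^{1-2/\gamma}\quad\text{for all } s\ge 1.$$ If $d\ge 4$, or if $d=3$ and $1/2\le\gamma<1$, then for all $N\ge 1$ $$\mathrm{Var}(f_N)\le 16C_0(D_0+1)N^{2-d+\gamma},$$ and for all $0<t<\left(\frac{C_0(D_0+1)^5}{8}\right)^{1/2}N^{(d-6+5\gamma)/2}$, $$\mathbb P(|f_N-\mathbb E f_N|>t)\le 11c_1\exp\left(-\frac{c_2}{2\sqrt{2C_0(D_0+1)}}\,N^{(d-2-\gamma)/2}\,t\right),$$ where $c_1,c_2$ are the universal constants of the martingale inequality recalled in the context; in particular they do not depend on $\kappa$, $d$ or $N$. (iii) If the tail condition in (ii) holds, $d=3$ and $0<\gamma\le 1/2$, then for all $N\ge1$, $\mathrm{Var}(f_N)\le 16C_0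(D_0+1)N^{-1/2}$.
   Context: $\mathbb L^d$ is the set of nearest-neighbour edges of $\mathbb Z^d$; $x\sim y$ means $|x-y|=1$ (Euclidean norm); $a(x,y)=a(y,x)$ is the conductance of the edge with endpoints $x\sim y$. $\mathbb P$ is the law of the conductances, with expectation $\mathbb E$ and variance $\mathrm{Var}$. $Q_N=\{1,\dots,N\}^d$, $\overline Q_N=\{0,\dots,N+1\}^d$, $\partial Q_N=\overline Q_N\setminus Q_N$; $x(1)$ is the first coordinate of $x$. $\mathcal V_N$ is the set of functions $u:\overline Q_N\to\mathbb R$ with $u=0$ on $\{x(1)=0\}\cap\partial Q_N$, $u=N+1$ on $\{x(1)=N+1\}\cap\partial Q_N$, and $u(x)=u(y)$ whenever $x\sim y$, $x\in\partial Q_N$ with $x(1)\notin\{0,N+1\}$, and $y\in Q_N$. $\mathcal E_N(u,v)=\sum a(x,y)(u(x)-u(y))(v(x)-v(y))$, the sum being over edges $\{x,y\}$ with $x\in Q_N$, $y\in\overline Q_N$, $x\sim y$, each edge counted once. $f_N=N^{-d}\mathcal E_N(v_N,v_N)=N^{-d}\inf\{\mathcal E_N(u,u):u\in\mathcal V_N\}$, where $v_N\in\mathcal V_N$ is the minimizer, i.e. the element of $\mathcal V_N$ with $\sum_{y\sim x}a(x,y)(v_N(x)-v_N(y))=0$ for all $x\in Q_N$ (unique up to its irrelevant values at vertices of $\partial Q_N$ having no neighbour in $Q_N$). Martingale inequality (Kesten) fixing the universal constants $c_1,c_2\in(0,\infty)$: let $(M_n;n\ge0)$ be a martingale with respect to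 a filtration $(\mathcal F_n)$ and $\Delta_k=M_k-M_{k-1}$. Suppose $|\Delta_k|\le B_1<\infty$ for all $k\ge1$; that for some random variables $U_k\ge0$ (not necessarily $\mathcal F_k$-measurable) $\mathbb E(\Delta_k^2|\mathcal F_{k-1})\le\mathbb E(U_k|\mathcal F_{k-1})$ for all $k\ge 1$; and that for constants $0<C_1,C_2<\infty$ and $s_0\ge e^2B_1^2$, $\mathbb P(\sum_kU_k>s)\le C_1\exp(-C_2s^2)$ for all $s\ge s_0$. Then for all $s>0$, $\mathbb P(|M_\infty-M_0|>s)\le c_1\left(1+C_1+\frac{C_1}{s_0^2C_2}\right)\exp\left(-c_2\frac{s}{s_0^{1/2}+(s/(s_0C_2))^{1/3}}\right)$, where $M_\infty$ is the limit of $M_n$ and $c_1,c_2$ do not depend on $B_1,s_0,C_1,C_2$ nor on the distribution of $(M_k)$ and $(U_k)$. *)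

(* Defs.v *)
From HB Require Import structures.
From mathcomp Require Import all_boot all_order all_algebra.
From mathcomp Require Import all_classical all_reals all_analysis.
From mathcomp Require Import measurable_realfun.

Set Implicit Arguments.
Unset Strict Implicit.
Unset Printing Implicit Defensive.

Import Order.TTheory GRing.Theory Num.Theory.
Import numFieldNormedType.Exports.

Local Open Scope classical_set_scope.
Local Open Scope ring_scope.

Notation Zd d := {ffun 'I_d -> int}.

(* The Euclidean norm of x - y is 1 iff its square is. *)
Definition adj d (x y : Zd d) : bool := \sum_i (x i - y i) ^+ 2 == 1.

(* An unoriented nearest-neighbour edge {x, x + e_i} is encoded by the pair
   (x, i); edgeP below shows that every edge has exactly one code. *)
Notation edge d := (Zd d * 'I_d)%type.

Definition unit_vec d (i : 'I_d) : Zd d := [ffun j => (j == i)%:Z].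
Definition src d (e : edge d) : Zd d := e.1.
Definition tgt d (e : edge d) : Zd d := e.1 + unit_vec e.2.

Lemma adj_edge d (e : edge d) : adj (src e) (tgt e).
Proof.
rewrite /adj /src /tgt (bigD1 e.2) //= big1 ?addr0 => [|j /negbTE ji];
  by rewrite !ffunE ?eqxx ?ji /= ?addr0 ?subrr // opprD addNKr sqrrN expr1n.
Qed.

Lemma edgeP d (x y : Zd d) : adj x y -> exists! e : edge d,
  (src e = x /\ tgt e = y) \/ (src e = y /\ tgt e = x).
Proof.
rewrite /adj => /eqP xy1.
have [i /eqP xyi] : exists i, x i - y i != 0.
  apply: contrapT => /forallNP xy0; move: xy1; rewrite big1 // => i _.
  by have /negP := xy0 i; rewrite negbK => /eqP ->; rewrite expr0n.
have sqr1 (z : int) : z != 0 -> 1 <= z ^+ 2.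
  by move=> z0; rewrite -gtz0_ge1 lt0r sqrf_eq0 z0 sqr_ge0.
move: xy1; rewrite (bigD1 i) //= => xy1.
have r0 : 0 <= \sum_(j < d | j != i) (x j - y j) ^+ 2.
  by apply: sumr_ge0 => j _; exact: sqr_ge0.
have s1 : (x i - y i) ^+ 2 = 1.
  apply/eqP; rewrite eq_le sqr1 ?andbT; last exact/eqP.
  by rewrite -xy1 lerDl.
have eqxy j : j != i -> x j = y j.
  move=> ji; apply/eqP; rewrite -subr_eq0 -sqrf_eq0.
  move: xy1; rewrite s1 => /eqP; rewrite -subr_eq0 addrAC subrr add0r.
  by rewrite psumr_eq0 => [/allP/(_ j (mem_index_enum j))|k _];
    [rewrite ji|exact: sqr_ge0].
have uniq (e : edge d) : (src e = x /\ tgt e = y) \/ (src e = y /\ tgt e = x) ->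
    e.2 = i.
  case: e => z k; rewrite /src /tgt /= => xyz; apply/eqP; apply: contraT => ki.
  have := eqxy k ki; case: xyz => -[<- <-] /eqP; rewrite !ffunE eqxx /=.
    by rewrite eq_sym -subr_eq0 addrAC subrr.
  by rewrite -subr_eq0 addrAC subrr.
have shift (u v : Zd d) : u i - v i = -1 -> (forall j, j != i -> u j = v j) ->
    tgt (u, i) = v.
  move=> uvi uv; apply/ffunP => j; rewrite !ffunE.
  case: eqP => [->|/eqP ji]; last by rewrite /= addr0 uv.
  by apply/eqP; rewrite /= -subr_eq0 addrAC uvi.
have anti (u v : Zd d) (e : edge d) : src e = u -> tgt e = v -> e.2 = i ->
    u i - v i = -1.
  by move=> <- <- <-; rewrite /src /tgt !ffunE eqxx opprD addrA subrr add0r.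
move/eqP: s1; rewrite sqrf_eq1 => /orP[|] /eqP si.
- have si' : y i - x i = -1 by rewrite -opprB si.
  exists (y, i); split.
    by right; split=> //; apply: shift => // j /eqxy.
  move=> e He; have ei := uniq e He; case: He => -[H1 H2].
    by have := anti _ _ e H1 H2 ei; rewrite si.
  by rewrite -H1 -ei /src -surjective_pairing.
- exists (x, i); split; first by left; split=> //; exact: shift.
  move=> e He; have ei := uniq e He; case: He => -[H1 H2].
    by rewrite -H1 -ei /src -surjective_pairing.
  by have := anti _ _ e H1 H2 ei; rewrite -opprB si.
Qed.

Definition box d (N : nat) (x : Zd d) : bool := [forall i, 1 <= x i <= N%:Z].
Definition cbox d (N : nat) (x : Zd d) : bool :=
  [forall i, 0 <= x i <= N.+1%:Z].
Definition bdry d (N : nat) (x : Zd d) : bool := cbox N x && ~~ box N x.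

Definition coord1 d (hd : (0 < d)%N) (x : Zd d) : int := x (Ordinal hd).

Section energy.
Context {R : realType}.

(* Potentials are total functions on Z^d; their values off cbox N are
   irrelevant, as neither admissible nor energy looks at them. *)
Definition admissible d (hd : (0 < d)%N) (N : nat) : set (Zd d -> R) :=
  [set u |
    [/\ forall x, bdry N x -> coord1 hd x = 0 -> u x = 0,
        forall x, bdry N x -> coord1 hd x = N.+1%:Z -> u x = N.+1%:R &
        forall x y, adj x y -> bdry N x -> coord1 hd x != 0 ->
          coord1 hd x != N.+1%:Z -> box N y -> u x = u y]].

Definition box_edges d (N : nat) : set (edge d) :=
  [set e | (box N (src e) && cbox N (tgt e)) ||
           (box N (tgt e) && cbox N (src e))].

Lemma finite_box_edges d N : finite_set (@box_edges d N).
Proof.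
pose g (p : {ffun 'I_d -> 'I_N.+2} * 'I_d) : edge d :=
  ([ffun i => (p.1 i : nat)%:Z], p.2).
apply: (@sub_finite_set _ _ (range g)); last first.
  by apply: finite_image; exact: finite_finset.
have bc (x : Zd d) : box N x -> cbox N x.
  move=> /forallP xN; apply/forallP => i; have /andP[x1 x2] := xN i.
  apply/andP; split; first exact: le_trans x1.
  by apply: (le_trans x2); rewrite lez_nat.
move=> [x k] /= xk.
have /forallP xc : cbox N x.
  by case/orP: xk => /andP[] // /bc.
exists ([ffun i => inord `|x i|%N], k) => //=; congr pair.
apply/ffunP => i; rewrite !ffunE; have /andP[x0 xN] := xc i.
by rewrite inordK ?gez0_abs // -ltz_nat gez0_abs.
Qed.

(* The index set is finite by finite_box_edges, so that the finitely
   supported sum is the ordinary one. *)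
Definition energy d (a : edge d -> R) (N : nat) (u v : Zd d -> R) : R :=
  \sum_(e \in box_edges N)
    a e * (u (src e) - u (tgt e)) * (v (src e) - v (tgt e)).

Definition eff_cond d (hd : (0 < d)%N) (a : edge d -> R) (N : nat) : R :=
  N%:R ^- d * inf [set energy a N u u | u in admissible hd N].

End energy.

Section probability_notions.
Context {R : realType} {disp : measure_display} {T : measurableType disp}.
Variable P : probability T R.

Local Open Scope ereal_scope.

Definition mutual_independence (I : choiceType) (X : I -> {RV P >-> R}) :=
  forall (J : seq I) (B : I -> set R), uniq J -> (forall i, measurable (B i)) ->
    P (\big[setI/setT]_(i <- J) (X i @^-1` B i)) =
    \prod_(i <- J) P (X i @^-1` B i).

Definition identically_distributed (I : Type) (X : I -> {RV P >-> R}) :=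
  forall (i j : I) (B : set R), measurable B ->
    distribution P (X i) B = distribution P (X j) B.

Definition inv_tail (I : Type) (X : I -> {RV P >-> R}) (D0 gamma : R) :=
  forall (i : I) (s : R), (1 <= s)%R ->
    P [set w | (s <= (X i w)^-1)%R] <= (D0 * s `^ (1 - 2 / gamma))%:E.

Definition sub_sigma_algebra (G : set (set T)) :=
  sigma_algebra setT G /\ G `<=` measurable.

(* Y is a version of E(X | G), for X integrable or nonnegative; Y is a version
   for a nonnegative X even if it takes the value +oo. *)
Definition is_cond_exp (G : set (set T)) (X Y : T -> \bar R) :=
  (forall B : set (\bar R), measurable B -> G (Y @^-1` B)) /\
  (forall A, G A -> \int[P]_(w in A) Y w = \int[P]_(w in A) X w).

Definition filtration (F : nat -> set (set T)) :=
  (forall n, sub_sigma_algebra (F n)) /\ (forall n, F n `<=` F n.+1).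

Definition martingale (F : nat -> set (set T)) (M : nat -> T -> R) :=
  [/\ forall n (B : set R), measurable B -> F n (M n @^-1` B),
      forall n, P.-integrable setT (EFin \o M n) &
      forall n, is_cond_exp (F n) (EFin \o M n.+1) (EFin \o M n)].

End probability_notions.

(* Kesten's martingale inequality holds with the constants c1 and c2, on all
   probability spaces and for all values of the parameters.  Relations between
   conditional expectations are a.s. relations between their versions.  The
   increment Delta_k (k >= 1) is M k - M k.-1; U 0 is not used. *)
Definition kesten_inequality (R : realType) (c1 c2 : R) : Prop :=
  forall (disp : measure_display) (T : measurableType disp)
    (P : probability T R) (F : nat -> set (set T)) (M : nat -> T -> R)
    (U : nat -> {RV P >-> R}) (Minf : {RV P >-> R}) (B1 C1 C2 s0 : R),
  let Delta k w := M k w - M k.-1 w in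
  filtration F ->
  martingale P F M ->
  (forall k, (1 <= k)%N -> {ae P, forall w, `|Delta k w| <= B1}) ->
  (forall k w, (1 <= k)%N -> 0 <= U k w) ->
  (forall k, (1 <= k)%N -> forall Y Z : T -> \bar R,
     is_cond_exp P (F k.-1) (fun w => (Delta k w ^+ 2)%:E) Y ->
     is_cond_exp P (F k.-1) (fun w => (U k w)%:E) Z ->
     {ae P, forall w, (Y w <= Z w)%E}) ->
  0 < C1 -> 0 < C2 -> expR 2 * B1 ^+ 2 <= s0 ->
  (forall s, s0 <= s ->
     (P [set w | s%:E < \sum_(1 <= k <oo) (U k w)%:E] <=
      (C1 * expR (- C2 * s ^+ 2))%:E)%E) ->
  {ae P, forall w, M n w @[n --> \oo] --> Minf w} ->
  forall s, 0 < s ->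
    (P [set w | (s < `|Minf w - M 0%N w|)%R] <=
     (c1 * (1 + C1 + C1 / (s0 ^+ 2 * C2)) *
      expR (- c2 * (s / (s0 `^ 2^-1 + (s / (s0 * C2)) `^ 3^-1))))%:E)%E.

(* Main.v *)
Require Import Defs.
From HB Require Import structures.
From mathcomp Require Import all_boot all_order all_algebra.
From mathcomp Require Import finmap.
From mathcomp Require Import all_classical all_reals all_analysis.
From mathcomp Require Import measurable_realfun ring lra zify.

Set Implicit Arguments.
Unset Strict Implicit.
Unset Printing Implicit Defensive.

Import Order.TTheory GRing.Theory Num.Theory.
Import numFieldNormedType.Exports.

Local Open Scope classical_set_scope.
Local Open Scope ring_scope.

(** Write [p e] for [N^-d * (u x - u y)^2], the energy that a potential [u]
    dissipates on the edge [e = {x, y}].  The effective conductance [f] is the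
    infimum over admissible [u] of the sums of [a e * p e], linear functions of
    the conductances with nonnegative coefficients.  Cutting [u] off at [0] and
    [N + 1] keeps it admissible and lowers every [p e], so only profiles with
    [p e <= L], where [L = N^-d * (N + 1)^2] is of order [N^(2 - d)], matter.
    Near-minimizers are good enough throughout, and no minimizing potential is
    ever constructed.

    Two facts about [f] follow.  Changing a single conductance moves [f] by at
    most [kappa * L].  Raising the conductance of [e] to its ceiling [kappa]
    moves [f] up by a gain that is at most [kappa * p e] for the profile of a
    near-minimizer, up to an arbitrarily small error, whence (lemma [sum_gain_sqr_le]) the squared gains add up to
    at most [kappa^2 * L] times the sum of the [p e].  The edges with
    [a e >= eps] contribute at most [f / eps] to the latter sum, because the sum
    of the [a e * p e] is nearly [f], and the others contribute at most [L]
    times their number.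

    The conductances are revealed one after another, and [M k] is the mean of
    [f] given the first [k] of them.  Given the past, the variance of [M k.+1]
    is at most its second moment about any quantity known in the past; taking
    the conditional mean of the effective conductance with the [k]-th
    conductance reset to [kappa] bounds the conditional second moment of the
    increment by that of the [k]-th gain (lemma [increment_sqr_le]).  Hence the
    variance of [f] is at most the mean of the sum of the squared gains (lemma
    [variance_le_sum_reset]).  There are at most [2 * d * N^d] edges, so the
    trivial bound [kappa * L] on each gain gives the variance bound of (i), and
    the increments being bounded by [kappa * L], the exponential moments of a
    martingale with bounded increments give its tail bound.

    For (ii) and (iii), take [eps = N^-gamma].  The mean number of edges with
    [a e < eps] is at most [2 * d * N^d * D0 * N^(gamma - 2)] by the tail
    condition, which makes both contributions to the sum of the squared gains
    of order [N^(2 - d + gamma)].  That number of edges is itself a function of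
    independent variables with differences bounded by [1], so it has a Gaussian
    tail, and so has the sum of the squared gains: this is the hypothesis of the
    martingale inequality, where the squared gains play the role of the [U k].
    The range of [t] in (ii) is the one in which the second term of the
    denominator in the martingale inequality is at most the first. *)

(** * Bounded measurable functions on a probability space *)

Section bounded_measurable.
Context {R : realType} {disp : measure_display} {T : measurableType disp}.
Implicit Types f g : T -> R.

Definition bmeas f := measurable_fun setT f /\ exists C, forall x, `|f x| <= C.

Lemma bmeas_cst c : bmeas (fun=> c).
Proof. by split; [exact: measurable_cst|exists `|c|]. Qed.

Lemma bmeasD f g : bmeas f -> bmeas g -> bmeas (fun x => f x + g x).
Proof.
move=> [mf [C fC]] [mg [D gD]]; split; first exact: measurable_funD.
by exists (C + D) => x; rewrite (le_trans (ler_normD _ _))// lerD.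
Qed.

Lemma bmeasM f g : bmeas f -> bmeas g -> bmeas (fun x => f x * g x).
Proof.
move=> [mf [C fC]] [mg [D gD]]; split; first exact: measurable_funM.
by exists (C * D) => x; rewrite normrM ler_pM.
Qed.

Lemma bmeasN f : bmeas f -> bmeas (fun x => - f x).
Proof.
move=> [mf [C fC]]; split; first exact: measurableT_comp.
by exists C => x; rewrite normrN.
Qed.

Lemma bmeasB f g : bmeas f -> bmeas g -> bmeas (fun x => f x - g x).
Proof. by move=> bf bg; apply: bmeasD => //; exact: bmeasN. Qed.

Lemma bmeasX f n : bmeas f -> bmeas (fun x => f x ^+ n).
Proof.
move=> bf; elim: n => [|n IHn]; first exact: bmeas_cst.
by under eq_fun do rewrite exprS; exact: bmeasM.
Qed.

Lemma bmeas_expR f : bmeas f -> bmeas (fun x => expR (f x)).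
Proof.
move=> [mf [C fC]]; split; first exact: measurableT_comp.
exists (expR C) => x; rewrite ger0_norm ?expR_ge0// ler_expR.
exact: le_trans (ler_norm _) (fC x).
Qed.

Lemma bmeas_sum (I : Type) (s : seq I) (f : I -> T -> R) :
  (forall i, bmeas (f i)) -> bmeas (fun x => \sum_(i <- s) f i x).
Proof.
move=> bf; elim: s => [|i s IHs].
  by under eq_fun do rewrite big_nil; exact: bmeas_cst.
by under eq_fun do rewrite big_cons; exact: bmeasD.
Qed.

Lemma bmeas_indic (A : set T) : measurable A -> bmeas (\1_A : T -> R).
Proof.
move=> mA; split; first exact: measurable_indic.
by exists 1 => x; rewrite indicE; case: (_ \in _); rewrite ?normr1 ?normr0.
Qed.

Variable P : probability T R.
Local Notation E f := (\int[P]_w (f w))%R.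

Lemma bmeas_integrable f : bmeas f -> P.-integrable setT (EFin \o f).
Proof.
move=> [mf [C fC]]; apply: measurable_bounded_integrable => //.
  by rewrite (le_lt_trans (probability_le1 _ _))// ltry.
by exists C; split; [exact: num_real|move=> y Cy x _; exact: le_trans (fC x) (ltW Cy)].
Qed.

Lemma bmeas_integralE f : bmeas f -> (\int[P]_w (f w)%:E)%E = (E f)%:E.
Proof.
by move=> /bmeas_integrable bf; rewrite /Rintegral fineK// integrable_fin_num.
Qed.

Lemma mean_cst c : E (fun=> c) = c.
Proof.
rewrite Rintegral_cst//; have -> : fine (P setT) = 1 by rewrite probability_setT.
by rewrite mulr1.
Qed.

Lemma meanD f g : bmeas f -> bmeas g ->
  E (fun w => f w + g w) = E f + E g.
Proof. by move=> bf bg; rewrite RintegralD//; exact: bmeas_integrable. Qed.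

Lemma meanB f g : bmeas f -> bmeas g ->
  E (fun w => f w - g w) = E f - E g.
Proof. by move=> bf bg; rewrite RintegralB//; exact: bmeas_integrable. Qed.

Lemma meanZ c f : bmeas f -> E (fun w => c * f w) = c * E f.
Proof. by move=> bf; rewrite RintegralZl//; exact: bmeas_integrable. Qed.

Lemma mean_le f g : bmeas f -> bmeas g -> (forall w, f w <= g w) ->
  E f <= E g.
Proof.
by move=> bf bg fg; apply: le_Rintegral => //; exact: bmeas_integrable.
Qed.

Lemma mean_sum (I : Type) (s : seq I) (f : I -> T -> R) :
  (forall i, bmeas (f i)) ->
  E (fun w => \sum_(i <- s) f i w) = \sum_(i <- s) E (f i).
Proof.
move=> bf; elim: s => [|i s IHs].
  by under eq_Rintegral do rewrite big_nil; rewrite mean_cst big_nil.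
under eq_Rintegral do rewrite big_cons.
by rewrite meanD ?big_cons ?IHs//; exact: bmeas_sum.
Qed.

Lemma mean_norm_le f C : bmeas f -> (forall w, `|f w| <= C) -> `|E f| <= C.
Proof.
move=> bf fC; have := fC point; move=> /(le_trans (normr_ge0 _)) C0.
have bC c : bmeas (fun=> c : R) by exact: bmeas_cst.
rewrite ler_norml; apply/andP; split.
  rewrite -[leLHS]mean_cst; apply: mean_le => // w.
  by have := fC w; rewrite ler_norml => /andP[].
by rewrite -[leRHS]mean_cst; apply: mean_le => // w; exact: le_trans (ler_norm _) _.
Qed.

(** Jensen, from the nonnegativity of the mean of [(f - m)^2], [m] the mean. *)
Lemma sqr_mean_le f : bmeas f -> (E f) ^+ 2 <= E (fun w => f w ^+ 2).
Proof.
move=> bf; set m := E f.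
have b2 : bmeas (fun w => f w ^+ 2) by exact: bmeasX.
have bm : bmeas (fun w => 2 * m * f w) by apply: bmeasM => //; exact: bmeas_cst.
have bc : bmeas (fun=> m ^+ 2 : R) by exact: bmeas_cst.
have : 0 <= E (fun w => f w ^+ 2 - 2 * m * f w + m ^+ 2).
  apply: Rintegral_ge0 => w _.
  by have := sqr_ge0 (f w - m); rewrite sqrrB mulr2n mulrDl !mul1r mulrDl (mulrC m).
rewrite meanD//; last exact: bmeasB.
rewrite meanB// meanZ// -/m mean_cst -subr_ge0 => /le_trans; apply.
by rewrite expr2 -mulrA mulrDl mul1r opprD !addrA subrK.
Qed.

Lemma prob_indic (A : set T) : measurable A -> P A = (E (\1_A : T -> R))%:E.
Proof.
move=> mA; rewrite -bmeas_integralE; last exact: bmeas_indic.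
by rewrite integral_indic// setIT.
Qed.

End bounded_measurable.

(** * Independence and decoupling *)

Section decoupling.
Context {R : realType} {disp : measure_display} {T : measurableType disp}.
Variable P : probability T R.

Definition independent_systems (G1 G2 : set (set T)) :=
  forall A B, <<s G1 >> A -> <<s G2 >> B -> P (A `&` B) = (P A * P B)%E.

Lemma g_sigma_measurable (G : set (set T)) :
  G `<=` measurable -> <<s G >> `<=` measurable.
Proof. by move=> mG; exact: (smallest_sub (@sigma_algebra_measurable _ T) mG). Qed.

Lemma measurable_to_g_sigma (G : set (set T)) : G `<=` measurable ->
  measurable_fun setT (id : T -> g_sigma_algebraType G).
Proof.
by move=> mG _ A mA; rewrite setTI; exact: (g_sigma_measurable mG mA).
Qed.

(** The product rule passes from pi-systems to the generated sigma-algebras one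
    argument at a time: with the other set fixed, both sides are finite measures
    that agree on a pi-system. *)
Lemma independent_systems_pi (G1 G2 : set (set T)) :
  G1 `<=` measurable -> G2 `<=` measurable ->
  setI_closed G1 -> setI_closed G2 -> G1 setT -> G2 setT ->
  (forall A B, G1 A -> G2 B -> P (A `&` B) = (P A * P B)%E) ->
  independent_systems G1 G2.
Proof.
move=> mG1 mG2 IG1 IG2 TG1 TG2 indep.
have half (G H : set (set T)) : G `<=` measurable -> H `<=` measurable ->
    setI_closed G -> G setT ->
    (forall A B, G A -> H B -> P (A `&` B) = (P A * P B)%E) ->
    forall A B, <<s G >> A -> H B -> P (A `&` B) = (P A * P B)%E.
  move=> mG mH IG TG GH A B sA HB; have mB := mH _ HB.
  have mBfin : P B \is a fin_num by rewrite fin_num_measure.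
  have B0 : 0 <= fine (P B) by rewrite fine_ge0.
  have := @g_sigma_algebra_measure_unique _ R T G mG (fun=> setT) (fun=> TG) _
    (mrestr P mB) (mscale (NngNum B0) P) IG.
  have mscaleE C : mscale (NngNum B0) P C = (P C * P B)%E.
    by rewrite /mscale /= fineK// muleC.
  move=> uniq; rewrite -mscaleE; apply: uniq => //; first by rewrite bigcup_const.
  - by move=> C GC; exact: etrans (GH _ _ GC HB) (esym (mscaleE C)).
  - move=> _; apply: (@le_lt_trans _ _ 1%E); last exact: ltry.
    by apply: probability_le1; exact: measurableI.
have h1 := half G1 G2 mG1 mG2 IG1 TG1 indep.
move=> A B sA sB; rewrite setIC muleC.
apply: (half G2 <<s G1 >>) => //; first exact: g_sigma_measurable.
by move=> C D GC sD; rewrite setIC muleC h1.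
Qed.

(** A function [h] of two points is taken measurable for [G1] in the first and
    for [G2] in the second: the product of the sigma-algebras is where
    independence makes [(w, w)] distributed as a pair of independent points. *)
Section fubini.
Variables G1 G2 : set (set T).
Hypothesis mG1 : G1 `<=` measurable.
Hypothesis mG2 : G2 `<=` measurable.
Let T1 : measurableType _ := g_sigma_algebraType G1.
Let T2 : measurableType _ := g_sigma_algebraType G2.
Let id1 : {mfun T >-> T1} := mfun_Sub (mem_set (measurable_to_g_sigma mG1)).
Let id2 : {mfun T >-> T2} := mfun_Sub (mem_set (measurable_to_g_sigma mG2)).
Let P1 : probability T1 R := distribution P id1.
Let P2 : probability T2 R := distribution P id2.

Lemma bmeas_weaken (f : T1 -> R) : bmeas f -> bmeas (f : T -> R).
Proof.
move=> [mf bf]; split=> //.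
exact: (measurableT_comp mf (measurable_to_g_sigma mG1)).
Qed.

Let mdiag : measurable_fun setT (fun w : T => (w : T1, w : T2)).
Proof.
by apply: measurable_fun_pair; exact: measurable_to_g_sigma.
Qed.
Let diag : {mfun T >-> (T1 * T2)%type} := mfun_Sub (mem_set mdiag).

Variable h : T1 * T2 -> R.
Hypothesis bh : bmeas h.

Lemma bmeas_diag : bmeas (fun w : T => h (w, w)).
Proof.
case: bh => mh [C hC]; split; last by exists C.
exact: (measurableT_comp mh mdiag).
Qed.

Lemma bmeas_section w : bmeas (fun w' : T => h (w, w')).
Proof.
case: bh => mh [C hC]; split; last by exists C.
apply: (measurableT_comp mh).
by apply: measurable_fun_pair; [exact: measurable_cst|exact: measurable_to_g_sigma].
Qed.

Let fubiniE w : fubini_F P2 (EFin \o h) w = (\int[P]_w' h (w, w'))%:E.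
Proof.
have [mh [C hC]] := bh.
rewrite -bmeas_integralE; last exact: bmeas_section.
rewrite /fubini_F /P2 integral_distribution//.
  by apply/measurable_EFinP; exact: (measurableT_comp mh (measurable_pair1 w)).
exact: (bmeas_integrable P (bmeas_section w)).
Qed.

Let integrable_h : (P1 \x P2)%E.-integrable setT (EFin \o h).
Proof.
have [mh [C hC]] := bh.
apply: measurable_bounded_integrable => //; last first.
  by exists C; split; [exact: num_real|move=> y Cy x _; exact: le_trans (hC x) (ltW Cy)].
have PT : (P1 \x P2)%E setT = 1%E.
  rewrite -setXTT product_measure1E//.
  by rewrite -[RHS]mule1; congr (_ * _)%E; exact: probability_setT.
by have := ltry (1 : R); rewrite -PT; exact.
Qed.

Lemma bmeas_partial_mean : bmeas (fun w : T1 => \int[P]_w' h (w, w')).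
Proof.
have [mh [C hC]] := bh; split; last first.
  by exists C => w; apply: mean_norm_le => //; exact: bmeas_section.
apply/measurable_EFinP.
rewrite (_ : _ \o _ = fubini_F P2 (EFin \o h)).
  exact: (measurable_fubini_F integrable_h).
by apply/funext => w; rewrite fubiniE.
Qed.

(** By uniqueness of product measures the diagonal map sends [P] to the product
    of its restrictions to the two sigma-algebras; then Fubini applies. *)
Lemma decoupling : independent_systems G1 G2 ->
  \int[P]_w h (w, w) = \int[P]_w \int[P]_w' h (w, w').
Proof.
move=> ind; have [mh [C hC]] := bh.
have PE X : measurable X -> (P1 \x P2)%E X = distribution P diag X.
  apply: product_measure_unique => A B mA mB; exact: ind.
apply: EFin_inj; rewrite -!bmeas_integralE; last 2 first.
- exact: (bmeas_weaken bmeas_partial_mean).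
- exact: bmeas_diag.
under [RHS]eq_integral do rewrite -fubiniE.
rewrite -[RHS](@integral_distribution _ _ _ T1 R P id1 (fubini_F P2 (EFin \o h))); last 2 first.
- exact: (measurable_fubini_F integrable_h).
- have := bmeas_integrable P (bmeas_weaken bmeas_partial_mean).
  by apply: eq_integrable => // w _; rewrite /= fubiniE.
rewrite integral12_prod_meas1//.
rewrite (eq_measure_integral (distribution P diag)); last by move=> A mA _; exact: PE.
rewrite integral_distribution//; first exact/measurable_EFinP.
exact: (bmeas_integrable P bmeas_diag).
Qed.

End fubini.
End decoupling.

(** * Sigma-algebras generated by families of independent coordinates *)

Section cylinders.
Context {R : realType} {disp : measure_display} {T : measurableType disp}.
Variable P : probability T R.
Context {I : choiceType}.
Variable X : I -> {RV P >-> R}.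
Implicit Types J K : set I.

(** The generators form a pi-system, which single preimages do not. *)
Definition cylinders J : set (set T) :=
  [set A | exists (s : seq I) (B : I -> set R),
     [/\ forall i, i \in s -> J i, forall i, measurable (B i) &
         A = [set w | forall i, i \in s -> B i (X i w)]]].

Let cylinderE (s : seq I) (B : I -> set R) :
  [set w | forall i, i \in s -> B i (X i w)] =
  \big[setI/setT]_(i <- undup s) (X i @^-1` B i).
Proof.
rewrite -bigcap_seq; apply/seteqP; split=> w /= wB i /=.
  by rewrite mem_undup => /wB.
by move=> si; apply: wB; rewrite /= mem_undup.
Qed.

Lemma cylinders_measurable J : cylinders J `<=` measurable.
Proof.
move=> _ [s [B [_ mB ->]]]; rewrite cylinderE.
by apply: bigsetI_measurable => i _; exact: measurable_funPTI.
Qed.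

Lemma cylindersT J : cylinders J setT.
Proof. by exists [::], (fun=> setT); split=> //; apply/seteqP; split. Qed.

Lemma cylindersI J : setI_closed (cylinders J).
Proof.
move=> _ _ [s [A [sJ mA ->]]] [t [B [tJ mB ->]]].
exists (s ++ t), (fun i => (if i \in s then A i else setT) `&`
                           (if i \in t then B i else setT)); split.
- by move=> i; rewrite mem_cat => /orP[/sJ|/tJ].
- by move=> i; apply: measurableI; case: ifP.
- apply/seteqP; split=> w /=.
    move=> [wA wB] i _; split; [case: ifPn => [/wA|]//|case: ifPn => [/wB|]//].
  by move=> wAB; split=> i si; have := wAB i; rewrite mem_cat si ?orbT => /(_ isT)[].
Qed.

Lemma subset_cylinders J K : J `<=` K -> cylinders J `<=` cylinders K.
Proof. by move=> JK _ [s [B [sJ mB ->]]]; exists s, B; split=> // i /sJ/JK. Qed.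

(** The product rule of [mutual_independence] applied to the concatenation of
    the two lists of indices splits into two products. *)
Lemma cylinders_independent J K : mutual_independence X -> J `&` K = set0 ->
  independent_systems P (cylinders J) (cylinders K).
Proof.
move=> indX JK0; apply: independent_systems_pi;
  [exact: cylinders_measurable|exact: cylinders_measurable|exact: cylindersI
  |exact: cylindersI|exact: cylindersT|exact: cylindersT|].
move=> _ _ [s [A [sJ mA ->]]] [t [B [tK mB ->]]].
pose C i := if i \in s then A i else B i.
have mC i : measurable (C i) by rewrite /C; case: ifP.
have ts i : i \in t -> i \notin s.
  by move=> /tK iK; apply/negP => /sJ iJ; have : (J `&` K) i by []; rewrite JK0.
rewrite !cylinderE.
have uniqst : uniq (undup s ++ undup t).
  rewrite cat_uniq !undup_uniq/= andbT; apply/hasPn => i.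
  by rewrite !mem_undup => /ts.
have eqA : \big[setI/setT]_(i <- undup s) (X i @^-1` A i) =
    \big[setI/setT]_(i <- undup s) (X i @^-1` C i).
  by apply: eq_big_seq => i; rewrite mem_undup /C => ->.
have eqB : \big[setI/setT]_(i <- undup t) (X i @^-1` B i) =
    \big[setI/setT]_(i <- undup t) (X i @^-1` C i).
  by apply: eq_big_seq => i; rewrite mem_undup /C => /ts/negbTE ->.
rewrite eqA eqB -big_cat indX//.
by rewrite !indX ?undup_uniq// big_cat.
Qed.

Lemma measurable_coordinate J i : J i ->
  measurable_fun setT (X i : g_sigma_algebraType (cylinders J) -> R).
Proof.
move=> Ji _ B mB; rewrite setTI; apply: sub_sigma_algebra.
exists [:: i], (fun=> B); split=> //; first by move=> j; rewrite inE => /eqP ->.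
apply/seteqP; split=> w /=; first by move=> wB j; rewrite inE => /eqP ->.
by apply; rewrite inE.
Qed.

End cylinders.

(** * The martingale of conditional means of a function of the coordinates *)

Section martingale_of_coordinates.
Context {R : realType} {disp : measure_display} {T : measurableType disp}.
Variable P : probability T R.
Context {I : choiceType}.
Variable X : I -> {RV P >-> R}.
Variable rho : I -> nat.
Variable D : set R.
Hypothesis indX : mutual_independence X.
Hypothesis XD : forall i w, D (X i w).

Local Notation Xs w := (fun i => X i w).

(** Bounded measurable functions of the family of coordinates, restricted to
    families with values in [D].  Measurability is asked along every measurable
    family on every space, which avoids a product sigma-algebra on [I -> R]. *)
Definition bcoord (F : (I -> R) -> R) : Prop :=
  (forall (d : measure_display) (S : measurableType d) (g : I -> S -> R),
    (forall i, measurable_fun setT (g i)) -> (forall i s, D (g i s)) ->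
    measurable_fun setT (fun s => F (fun i => g i s))) /\
  (exists C, forall x, (forall i, D (x i)) -> `|F x| <= C).

Lemma bcoord_bmeas F (d : measure_display) (S : measurableType d)
    (g : I -> S -> R) :
  bcoord F -> (forall i, measurable_fun setT (g i)) -> (forall i s, D (g i s)) ->
  bmeas (fun s => F (fun i => g i s)).
Proof.
move=> [mF [C FC]] mg gD; split; first exact: mF.
by exists C => s; apply: FC => i.
Qed.

Lemma bcoord_bmeasX F : bcoord F -> bmeas (fun w => F (Xs w)).
Proof. by move=> bF; apply: bcoord_bmeas => // i. Qed.

Lemma bcoordB F G : bcoord F -> bcoord G -> bcoord (fun x => F x - G x).
Proof.
move=> [mF [C FC]] [mG [C' GC]]; split.
  by move=> d S g mg gD; apply: measurable_funB; [exact: mF|exact: mG].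
by exists (C + C') => x xD; rewrite (le_trans (ler_normB _ _))// lerD ?FC ?GC.
Qed.

Lemma bcoord_sqr F : bcoord F -> bcoord (fun x => F x ^+ 2).
Proof.
move=> [mF [C FC]]; split.
  by move=> d S g mg gD; apply: measurable_funX; exact: mF.
by exists (C ^+ 2) => x xD; rewrite normrX lerXn2r ?nnegrE ?FC// (le_trans _ (FC x xD)).
Qed.

Definition reset k c (x : I -> R) : I -> R :=
  fun i => if rho i == k then c else x i.

Lemma bcoord_reset k c F : D c -> bcoord F -> bcoord (F \o reset k c).
Proof.
move=> Dc [mF [C FC]]; split; last first.
  by exists C => x xD; apply: FC => i; rewrite /reset; case: ifP.
move=> d S g mg gD.
apply: (mF _ _ (fun i s => if rho i == k then c else g i s)).
  by move=> i; case: (rho i == k) => //; exact: measurable_cst.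
by move=> i s; case: ifP.
Qed.

(** The coordinates of rank below [k] come from [w], the others from an
    independent copy [w']; integrating [w'] out gives a version of the mean given
    the coordinates of rank below [k] that is defined at every [w]. *)
Definition glue k (w w' : T) : I -> R :=
  fun i => if (rho i < k)%N then X i w else X i w'.

Definition partial_mean (F : (I -> R) -> R) k w :=
  \int[P]_w' F (glue k w w').

Definition past k : set (set T) := cylinders X [set i | (rho i < k)%N].
Definition future k : set (set T) := cylinders X [set i | (k <= rho i)%N].

Lemma past_measurable k : past k `<=` measurable.
Proof. exact: cylinders_measurable. Qed.

Let future_measurable k : future k `<=` measurable.
Proof. exact: cylinders_measurable. Qed.

Lemma subset_past k l : (k <= l)%N -> past k `<=` past l.
Proof. by move=> kl; apply: subset_cylinders => i /leq_trans; exact. Qed.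

Lemma independent_past_future k : independent_systems P (past k) (future k).
Proof.
apply: cylinders_independent => //; apply/seteqP; split=> // i /= [].
by rewrite ltnNge => /negP.
Qed.

Local Notation pastType k := (g_sigma_algebraType (past k)).
Local Notation futureType k := (g_sigma_algebraType (future k)).

Lemma glue_diag k w : glue k w w = Xs w.
Proof. by apply/funext => i; rewrite /glue; case: ifP. Qed.

Lemma glue_range k w w' i : D (glue k w w' i).
Proof. by rewrite /glue; case: ifP. Qed.

Lemma bmeas_glue F k : bcoord F ->
  bmeas (fun z : pastType k * futureType k => F (glue k z.1 z.2)).
Proof.
move=> bF; apply: (@bcoord_bmeas F _ (pastType k * futureType k)%type
  (fun i z => glue k z.1 z.2 i)) => //.
  move=> i; rewrite /glue; case: (boolP (rho i < k)%N) => ik.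
    have mXi := @measurable_coordinate _ _ _ _ _ X [set i | (rho i < k)%N] i ik.
    exact: (measurableT_comp mXi measurable_fst).
  have {}ik : (k <= rho i)%N by rewrite leqNgt.
  have mXi := @measurable_coordinate _ _ _ _ _ X [set i | (k <= rho i)%N] i ik.
  exact: (measurableT_comp mXi measurable_snd).
by move=> i z; exact: glue_range.
Qed.

Lemma bmeas_partial_mean_past F k : bcoord F ->
  bmeas (partial_mean F k : pastType k -> R).
Proof.
move=> bF.
exact: (bmeas_partial_mean P (@past_measurable k) (@future_measurable k) (bmeas_glue k bF)).
Qed.

Lemma bmeas_past_le k l (g : T -> R) : (k <= l)%N ->
  bmeas (g : pastType k -> R) -> bmeas (g : pastType l -> R).
Proof.
move=> kl [mg bg]; split=> // _ B mB; rewrite setTI.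
have := mg measurableT B mB; rewrite setTI.
exact: (sub_smallest2r (smallest_sigma_algebra _ _) (subset_past kl)).
Qed.

Lemma bmeas_past k (g : T -> R) : bmeas (g : pastType k -> R) -> bmeas g.
Proof. exact: (bmeas_weaken (@past_measurable k)). Qed.

Lemma bmeas_partial_mean_T F k : bcoord F -> bmeas (partial_mean F k).
Proof. by move=> bF; apply: (@bmeas_past k); exact: bmeas_partial_mean_past. Qed.

Lemma bmeas_glue_section F k w : bcoord F -> bmeas (fun w' => F (glue k w w')).
Proof.
move=> bF; exact: (bmeas_section (@future_measurable k) (bmeas_glue k bF) w).
Qed.

(** The defining property of a conditional mean: [partial_mean F k] is a version
    of the mean of [F] given the past. *)
Lemma tower F k (g : T -> R) : bcoord F -> bmeas (g : pastType k -> R) ->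
  \int[P]_w (g w * F (Xs w)) = \int[P]_w (g w * partial_mean F k w).
Proof.
move=> bF bg.
have bh : bmeas (fun z : pastType k * futureType k => g z.1 * F (glue k z.1 z.2)).
  apply: bmeasM; last exact: bmeas_glue.
  case: bg => mg [C gC]; split; last by exists C.
  by apply: (measurableT_comp mg); exact: measurable_fst.
have := decoupling (@past_measurable k) (@future_measurable k) bh
  (@independent_past_future k).
under eq_Rintegral do rewrite /= glue_diag.
move=> ->; apply: eq_Rintegral => w _ /=.
by rewrite meanZ//; exact: bmeas_glue_section.
Qed.

Lemma partial_mean_orthogonal F k l (g : T -> R) : bcoord F -> (k <= l)%N ->
  bmeas (g : pastType k -> R) ->
  \int[P]_w (g w * partial_mean F l w) = \int[P]_w (g w * partial_mean F k w).
Proof.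
by move=> bF kl bg; rewrite -!tower//; exact: bmeas_past_le bg.
Qed.

Definition rank_local m (F : (I -> R) -> R) :=
  forall x y, (forall i, (rho i < m)%N -> x i = y i) -> F x = F y.

(** Coordinates of rank at least [m] do not matter, so nothing is left to
    integrate. *)
Lemma partial_mean_local F m k w : rank_local m F -> (m <= k)%N ->
  partial_mean F k w = F (Xs w).
Proof.
move=> lF mk; rewrite /partial_mean.
under eq_Rintegral => w' _.
  rewrite (lF _ (Xs w)); last first.
    by move=> i im; rewrite /glue (leq_trans im mk).
  over.
by rewrite mean_cst.
Qed.

Lemma partial_meanB F G k w : bcoord F -> bcoord G ->
  partial_mean (fun x => F x - G x) k w = partial_mean F k w - partial_mean G k w.
Proof. by move=> bF bG; rewrite /partial_mean meanB//; exact: bmeas_glue_section. Qed.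

(** Levels [k] and [k.+1] glue differently only at rank [k], where the
    coordinates are overwritten. *)
Lemma partial_mean_reset F k c w :
  partial_mean (F \o reset k c) k.+1 w = partial_mean (F \o reset k c) k w.
Proof.
apply: eq_Rintegral => w' _ /=; congr F; apply/funext => i; rewrite /reset /glue.
by case: eqP => // /eqP ik; rewrite ltnS leq_eqVlt (negbTE ik).
Qed.

Lemma partial_mean_diff F k c w : bcoord F ->
  (forall x y, (forall i, D (x i)) -> (forall i, D (y i)) ->
     (forall i, rho i != k -> x i = y i) -> `|F x - F y| <= c) ->
  `|partial_mean F k.+1 w - partial_mean F k w| <= c.
Proof.
move=> bF Fc; have bs l := bmeas_glue_section l w bF.
rewrite /partial_mean -meanB//; apply: mean_norm_le => [|w']; first exact: bmeasB.
apply: Fc => [i|i|i ik]; [exact: glue_range|exact: glue_range|].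
by rewrite /glue ltnS leq_eqVlt (negbTE ik).
Qed.

(** The key comparison.  The weight [g] stands for an arbitrary event of the
    past.  Resetting rank [k] to a constant gives a quantity [V] that is known in
    the past and that also equals the mean at level [k.+1] of the reset function,
    so that Jensen applies to [M k.+1 - V]. *)
Lemma increment_sqr_le F k c (g : T -> R) : bcoord F -> D c ->
  bmeas (g : pastType k -> R) -> (forall w, 0 <= g w) ->
  \int[P]_w (g w * (partial_mean F k.+1 w - partial_mean F k w) ^+ 2) <=
  \int[P]_w (g w * (F (Xs w) - F (reset k c (Xs w))) ^+ 2).
Proof.
move=> bF Dc bg g0.
pose V := partial_mean (F \o reset k c) k.
pose M l := partial_mean F l.
have bR := bcoord_reset k Dc bF.
have bV : bmeas (V : pastType k -> R) by exact: bmeas_partial_mean_past.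
have bMk : bmeas (M k : pastType k -> R) by exact: bmeas_partial_mean_past.
have bg' := bmeas_past bg; have bV' := bmeas_past bV; have bMk' := bmeas_past bMk.
have bM1 : bmeas (M k.+1) by exact: bmeas_partial_mean_T.
have bcross : bmeas ((fun w => 2 * g w * (M k w - V w)) : pastType k -> R).
  by apply: bmeasM; [apply: bmeasM => //; exact: bmeas_cst|exact: bmeasB].
(* given the past, M k is the mean of M k.+1, so that the second moment of
   M k.+1 about M k is the smallest *)
have step1 : \int[P]_w (g w * (M k.+1 w - M k w) ^+ 2) <=
    \int[P]_w (g w * (M k.+1 w - V w) ^+ 2).
  have split_sqr w : g w * (M k.+1 w - V w) ^+ 2 =
      g w * (M k.+1 w - M k w) ^+ 2 + (2 * g w * (M k w - V w)) * M k.+1 w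
      - (2 * g w * (M k w - V w)) * M k w + g w * (M k w - V w) ^+ 2.
    by rewrite !expr2; ring.
  under [leRHS]eq_Rintegral do rewrite split_sqr.
  have bsq f : bmeas f -> bmeas (fun w => g w * f w ^+ 2).
    by move=> bf; apply: bmeasM => //; exact: bmeasX.
  have bc := bmeas_past bcross.
  have b1 := bsq _ (bmeasB bM1 bMk').
  have b2 := bmeasM bc bM1.
  have b3 := bmeasM bc bMk'.
  have b4 := bsq _ (bmeasB bMk' bV').
  rewrite (meanD P (bmeasB (bmeasD b1 b2) b3) b4) (meanB P (bmeasD b1 b2) b3).
  rewrite (meanD P b1 b2) (partial_mean_orthogonal bF (leqnSn k) bcross) addrK.
  by rewrite lerDl; apply: Rintegral_ge0 => w _; rewrite mulr_ge0// sqr_ge0.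
apply: (le_trans step1).
pose G x := F x - F (reset k c x).
have bG : bcoord G by exact: (bcoordB bF bR).
have -> : \int[P]_w (g w * (F (Xs w) - F (reset k c (Xs w))) ^+ 2) =
    \int[P]_w (g w * partial_mean (fun x => G x ^+ 2) k.+1 w).
  rewrite -tower//; first exact: bcoord_sqr.
  exact: bmeas_past_le bg.
apply: mean_le.
- exact: (bmeasM bg' (bmeasX 2 (bmeasB bM1 bV'))).
- exact: (bmeasM bg' (bmeas_partial_mean_T k.+1 (bcoord_sqr bG))).
- move=> w; apply: ler_wpM2l => //.
  rewrite /V -partial_mean_reset -(partial_meanB _ _ bF bR).
  exact: (sqr_mean_le P (bmeas_glue_section k.+1 w bG)).
Qed.

End martingale_of_coordinates.

(** * Comparison of versions of conditional expectations *)

Section conditional_expectation_comparison.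
Context {R : realType} {disp : measure_display} {T : measurableType disp}.
Variable P : probability T R.
Local Open Scope ereal_scope.

(** [Z] is a.e. nonnegative, since its integrals over the events of the
    sigma-algebra are; the event where [0 <= Z < Y] belongs to it, and there
    [Y - Z] would have an integral that is at most [0]. *)
Lemma ae_is_cond_exp_le (G : set (set T)) (X1 X2 : T -> R) (Y Z : T -> \bar R) :
  G `<=` measurable -> bmeas X1 -> bmeas X2 -> (forall w, (0 <= X1 w)%R) ->
  (forall w, (0 <= X2 w)%R) ->
  (forall A, <<s G >> A -> \int[P]_(w in A) (X1 w)%:E <= \int[P]_(w in A) (X2 w)%:E) ->
  is_cond_exp P <<s G >> (EFin \o X1) Y ->
  is_cond_exp P <<s G >> (EFin \o X2) Z ->
  {ae P, forall w, Y w <= Z w}.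
Proof.
move=> mG b1 b2 X10 X20 X12 [GY EY] [GZ EZ].
pose TG : measurableType _ := g_sigma_algebraType G.
have GT := g_sigma_measurable mG.
have mYG : measurable_fun setT (Y : TG -> \bar R).
  by move=> _ B mB; rewrite setTI; exact: GY.
have mZG : measurable_fun setT (Z : TG -> \bar R).
  by move=> _ B mB; rewrite setTI; exact: GZ.
have mY : measurable_fun setT Y by move=> _ B mB; rewrite setTI; exact: (GT _ (GY _ mB)).
have mZ : measurable_fun setT Z by move=> _ B mB; rewrite setTI; exact: (GT _ (GZ _ mB)).
have fin2 A : <<s G >> A -> \int[P]_(w in A) (X2 w)%:E < +oo.
  move=> GA; apply: le_lt_trans (ltry (\int[P]_w X2 w)%R).
  rewrite -bmeas_integralE//; apply: ge0_subset_integral => //.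
  - exact: GT.
  - by apply/measurable_EFinP; case: b2.
  - by move=> w _; rewrite lee_fin.
pose N := [set w | Z w < 0].
have GN : <<s G >> N.
  have := measurable_lte (D := [set: TG]) measurableT mZG (measurable_cst 0).
  by rewrite setTI.
have Z0 : {ae P, forall w, N w -> Z w = 0}.
  apply/(ae_eq_integral_abs P (GT _ GN) (measurable_funTS mZ)).
  apply/eqP; rewrite eq_le integral_ge0 ?andbT; last by move=> w _; exact: abse_ge0.
  rewrite (eq_integral (fun w => - Z w)); last first.
    by move=> w; rewrite inE => Nw; rewrite lte0_abs.
  rewrite -[leLHS]oppeK -integral_ge0N; last by move=> w /ltW; rewrite leeNr oppe0.
  under eq_integral do rewrite oppeK.
  rewrite leeNl oppe0.
  by rewrite EZ//; apply: integral_ge0 => w _; rewrite lee_fin.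
pose A := [set w | 0 <= Z w] `&` [set w | Z w < Y w].
have GA : <<s G >> A.
  have mA1 := measurable_lee (D := [set: TG]) measurableT (measurable_cst 0) mZG.
  have mA2 := measurable_lte (D := [set: TG]) measurableT mZG mYG.
  rewrite setTI in mA1; rewrite setTI in mA2.
  exact: (@measurableI _ TG).
have mA := GT _ GA.
have intZ : P.-integrable A Z.
  apply/integrableP; split; first exact: measurable_funTS.
  rewrite (eq_integral Z); last by move=> w /[!inE] -[/= Zw _]; rewrite gee0_abs.
  by rewrite EZ// fin2.
have YA : \int[P]_(w in A) Y w <= \int[P]_(w in A) Z w by rewrite EY// EZ// X12.
have intY : P.-integrable A Y.
  apply/integrableP; split; first exact: measurable_funTS.
  rewrite (eq_integral Y); last first.
    by move=> w /[!inE] -[/= Zw /ltW/(le_trans Zw) Yw]; rewrite gee0_abs.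
  by rewrite (le_lt_trans YA)// EZ// fin2.
have YZ : {ae P, forall w, A w -> Y w - Z w = 0}.
  apply/(ae_eq_integral_abs P mA (measurable_funTS (emeasurable_funB mY mZ))).
  apply/eqP; rewrite eq_le integral_ge0 ?andbT; last by move=> w _; exact: abse_ge0.
  rewrite (eq_integral (fun w => Y w - Z w)); last first.
    move=> w; rewrite inE => -[/= Zw YZw]; rewrite gee0_abs// sube_ge0 ?ltW//.
    by rewrite ge0_fin_numE// (lt_le_trans YZw)// leey.
  have -> : \int[P]_(w in A) (Y w - Z w) = \int[P]_(w in A) Y w - \int[P]_(w in A) Z w.
    exact: integralB.
  by rewrite sube_le0.
apply: filterS2 Z0 YZ => w wZ wYZ; rewrite leNgt; apply/negP => ZY.
have [Zw|Zw] := leP 0 (Z w).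
  have /eqP := wYZ (conj Zw ZY).
  by case: (Z w) Zw ZY => // r _; case: (Y w) => // s; rewrite lte_fin -EFinB eqe subr_eq0 => /gt_eqF ->.
by have := Zw; rewrite wZ// ltxx.
Qed.

End conditional_expectation_comparison.

(** * Variance and concentration *)

Section martingale_inequalities.
Context {R : realType}.

(** For [x <= 1/2] invert [1 - x <= exp (- x)]; for larger [x] the exponent
    [2 * x^2] is already at least [x].  Centered variables lose the linear term,
    which leaves a subgaussian bound. *)
Lemma expR_le_add_sqr (x : R) : expR x <= x + expR (2 * x ^+ 2).
Proof.
have [x12|x12] := leP x 2^-1; last first.
  have x0 : 0 < x by apply: lt_trans x12; rewrite invr_gt0.
  apply: (@le_trans _ _ (expR (2 * x ^+ 2))); last by rewrite lerDr ltW.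
  by rewrite ler_expR; nra.
have h : expR x <= 1 + x + 2 * x ^+ 2.
  have e1 : (1 - x) * expR x <= 1.
    rewrite -[leRHS](expRxMexpNx_1 x) mulrC ler_wpM2l ?expR_ge0//.
    exact: expR_ge1Dx.
  have x1 : 0 < 1 - x by lra.
  rewrite -(ler_pM2l x1); apply: (le_trans e1).
  by have := sqr_ge0 x; nra.
apply: (le_trans h); rewrite addrAC addrC lerD2l; exact: expR_ge1Dx.
Qed.

Context {disp : measure_display} {T : measurableType disp}.
Variable P : probability T R.
Context {I : choiceType}.
Variable X : I -> {RV P >-> R}.
Variable rho : I -> nat.
Variable D : set R.
Hypothesis indX : mutual_independence X.
Hypothesis XD : forall i w, D (X i w).
Variable F : (I -> R) -> R.
Hypothesis bF : bcoord D F.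
Variable m : nat.
Hypothesis lF : rank_local rho m F.

Local Notation Xs w := (fun i => X i w).
Local Notation M := (partial_mean X rho F).
Local Notation EF := (\int[P]_w F (fun i => X i w)).

Let bM k : bmeas (M k). Proof. exact: bmeas_partial_mean_T XD _ _ bF. Qed.

Let bMpast k : bmeas (M k : g_sigma_algebraType (past X rho k) -> R).
Proof. exact: bmeas_partial_mean_past XD _ _ bF. Qed.

Let bXs : bmeas (fun w => F (Xs w)). Proof. exact: bcoord_bmeasX bF. Qed.

Let M0E w : M 0 w = EF. Proof. by []. Qed.

Let MmE w : M m w = F (Xs w). Proof. exact: partial_mean_local lF _. Qed.

(** Increments are orthogonal to the past. *)
Lemma martingale_sqr_sum n :
  \int[P]_w ((M n w - EF) ^+ 2) =
  \sum_(k < n) \int[P]_w ((M k.+1 w - M k w) ^+ 2).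
Proof.
elim: n => [|n IHn].
  by rewrite big_ord0; under eq_Rintegral do rewrite M0E subrr expr0n; rewrite mean_cst.
rewrite big_ord_recr /= -IHn.
pose g w := 2 * (M n w - EF).
have bg : bmeas (g : g_sigma_algebraType (past X rho n) -> R).
  by apply: bmeasM; [exact: bmeas_cst|apply: bmeasB => //; exact: bmeas_cst].
have bg' := bmeas_past bg.
have E w : (M n.+1 w - EF) ^+ 2 = (M n w - EF) ^+ 2
    + (M n.+1 w - M n w) ^+ 2 + g w * M n.+1 w - g w * M n w.
  by rewrite /g !expr2; ring.
under eq_Rintegral do rewrite E.
have b1 : bmeas (fun w => (M n w - EF) ^+ 2).
  by apply: bmeasX; apply: bmeasB => //; exact: bmeas_cst.
have b2 : bmeas (fun w => (M n.+1 w - M n w) ^+ 2).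
  by apply: bmeasX; exact: bmeasB.
have b3 := bmeasM bg' (bM n.+1).
have b4 := bmeasM bg' (bM n).
rewrite (meanB P (bmeasD (bmeasD b1 b2) b3) b4) (meanD P (bmeasD b1 b2) b3).
by rewrite (partial_mean_orthogonal indX XD bF (leqnSn n) bg) addrK meanD.
Qed.

(** An Efron-Stein inequality in which the coordinate is reset to a fixed value
    instead of being resampled. *)
Lemma variance_le_sum_reset c : D c ->
  ('V_P[fun w => F (Xs w)] <=
   (\sum_(k < m) \int[P]_w ((F (Xs w) - F (reset rho k c (Xs w))) ^+ 2))%:E)%E.
Proof.
move=> Dc.
have -> : 'V_P[fun w => F (Xs w)] = (\int[P]_w ((M m w - EF) ^+ 2))%:E.
  rewrite /variance unlock unlock /=.
  rewrite -bmeas_integralE; last first.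
    by apply: bmeasX; apply: bmeasB => //; exact: bmeas_cst.
  by apply: eq_integral => w _; rewrite MmE expr2.
rewrite lee_fin martingale_sqr_sum; apply: ler_sum => k _.
have b1 : bmeas ((fun=> 1) : g_sigma_algebraType (past X rho k) -> R).
  exact: bmeas_cst.
have := increment_sqr_le indX XD bF Dc b1 (fun=> ler01).
under eq_Rintegral do rewrite mul1r.
by under [X in _ <= X -> _]eq_Rintegral do rewrite mul1r.
Qed.

Section bounded_differences.
Variable B : R.
Hypothesis FB : forall k x y, (k < m)%N -> (forall i, D (x i)) ->
  (forall i, D (y i)) -> (forall i, rho i != k -> x i = y i) -> `|F x - F y| <= B.

Lemma bounded_increment k w : (k < m)%N -> `|M k.+1 w - M k w| <= B.
Proof. by move=> km; apply: partial_mean_diff XD _ _ _ _ bF _ => x y; exact: FB. Qed.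

(** One factor [expR (2 * l^2 * B^2)] per step: by [expR_le_add_sqr] the
    exponential of an increment is at most that constant plus a term that is
    linear in the increment, and orthogonal to the past. *)
Lemma mean_expR_le (l : R) :
  \int[P]_w expR (l * (F (Xs w) - EF)) <= expR (m%:R * (2 * l ^+ 2 * B ^+ 2)).
Proof.
have bexp k : bmeas (fun w => expR (l * (M k w - EF))).
  apply: bmeas_expR; apply: bmeasM; first exact: bmeas_cst.
  by apply: bmeasB => //; exact: bmeas_cst.
have bexpP k : bmeas ((fun w => expR (l * (M k w - EF))) :
    g_sigma_algebraType (past X rho k) -> R).
  apply: bmeas_expR; apply: bmeasM; first exact: bmeas_cst.
  by apply: bmeasB => //; exact: bmeas_cst.
suff H k : (k <= m)%N -> \int[P]_w expR (l * (M k w - EF)) <=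
    expR (k%:R * (2 * l ^+ 2 * B ^+ 2)).
  by have := H m (leqnn m); under eq_Rintegral do rewrite MmE.
elim: k => [_|k IHk km].
  rewrite mul0r expR0; under eq_Rintegral do rewrite M0E subrr mulr0 expR0.
  by rewrite mean_cst.
pose g w := expR (l * (M k w - EF)).
set q := 2 * l ^+ 2 * B ^+ 2.
have qE : expR (k.+1%:R * q) = expR q * expR (k%:R * q).
  by rewrite -expRD mulrS mulrDl mul1r.
rewrite qE; apply: (@le_trans _ _ (expR q * \int[P]_w g w)); last first.
  by rewrite ler_wpM2l ?expR_ge0// IHk// ltnW.
pose h w := l * g w.
have bh : bmeas (h : g_sigma_algebraType (past X rho k) -> R).
  by apply: bmeasM; [exact: bmeas_cst|exact: bexpP].
have bh' := bmeas_past bh.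
have bq : bmeas (fun w => expR q * g w).
  by apply: bmeasM; [exact: bmeas_cst|exact: bexp].
apply: (@le_trans _ _ (\int[P]_w (h w * M k.+1 w - h w * M k w + expR q * g w))).
  apply: mean_le => //.
    by apply: bmeasD => //; apply: bmeasB; exact: bmeasM.
  move=> w; have -> : l * (M k.+1 w - EF) =
      l * (M k w - EF) + l * (M k.+1 w - M k w) by ring.
  rewrite expRD -/(g w) /h -mulrBr -mulrA mulrCA (mulrC (expR q)) -mulrDr.
  rewrite ler_wpM2l ?expR_ge0//.
  apply: (le_trans (expR_le_add_sqr _)); rewrite lerD2l ler_expR /q.
  rewrite exprMn mulrA ler_wpM2l//; first by apply: mulr_ge0 => //; exact: sqr_ge0.
  rewrite -[leLHS]real_normK ?num_real// lerXn2r ?nnegrE ?bounded_increment//.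
  exact: le_trans (bounded_increment w km).
rewrite (meanD P (bmeasB (bmeasM bh' (bM k.+1)) (bmeasM bh' (bM k))) bq).
rewrite (meanB P (bmeasM bh' (bM k.+1)) (bmeasM bh' (bM k))).
rewrite (partial_mean_orthogonal indX XD bF (leqnSn k) bh) subrr add0r.
by rewrite meanZ//; exact: bexp.
Qed.

(** Markov's inequality for the exponential moment; the choice of [l] is left to
    the applications. *)
Lemma bounded_differences_upper_tail (l r : R) : 0 <= l ->
  (P [set w | (r <= F (Xs w) - EF)%R] <=
   (expR (m%:R * (2 * l ^+ 2 * B ^+ 2) - l * r))%:E)%E.
Proof.
move=> l0; set A := [set w | _].
have bc : bmeas (fun _ : T => EF) by exact: bmeas_cst.
have mA : measurable A.
  have [mf _] := bmeasB bXs bc.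
  rewrite /A -[X in measurable X]setTI; exact: measurable_fun_le.
rewrite (prob_indic P mA) lee_fin addrC expRD.
have be : bmeas (fun w => expR (l * (F (Xs w) - EF))).
  by apply: bmeas_expR; apply: bmeasM; [exact: bmeas_cst|exact: bmeasB].
apply: (@le_trans _ _ (expR (- (l * r)) * \int[P]_w expR (l * (F (Xs w) - EF)))).
  rewrite -meanZ//; apply: mean_le.
  - exact: bmeas_indic.
  - by apply: bmeasM => //; exact: bmeas_cst.
  - move=> w; rewrite -expRD indicE; case: (boolP (w \in A)); last by rewrite expR_ge0.
    by rewrite inE /A /= => rw; rewrite -expR0 ler_expR addrC subr_ge0 ler_wpM2l.
by rewrite ler_wpM2l ?expR_ge0// mean_expR_le.
Qed.

End bounded_differences.

Local Notation pastG k := <<s past X rho k >>.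

Let past_T k A : pastG k A -> measurable A.
Proof. exact: (g_sigma_measurable (@past_measurable _ _ _ _ _ X rho k)). Qed.

Lemma past_filtration : filtration (fun k => pastG k).
Proof.
split=> n.
  by split; [exact: smallest_sigma_algebra|move=> A; exact: past_T].
by apply: sub_smallest2r; [exact: smallest_sigma_algebra|exact: subset_past].
Qed.

Lemma set_integral_indic (A : set T) (f : T -> R) : measurable A -> bmeas f ->
  (\int[P]_(w in A) (f w)%:E)%E = (\int[P]_w (\1_A w * f w))%:E.
Proof.
move=> mA bf; rewrite -bmeas_integralE; last first.
  by apply: bmeasM => //; exact: bmeas_indic.
rewrite integral_mkcond; apply: eq_integral => w _.
by rewrite patchE indicE; case: ifP; rewrite ?mul1r ?mul0r.
Qed.

Let bmeas_indic_past k A : pastG k A ->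
  bmeas (\1_A : g_sigma_algebraType (past X rho k) -> R).
Proof. by move=> GA; exact: bmeas_indic. Qed.

Lemma partial_mean_martingale : martingale P (fun k => pastG k) M.
Proof.
split.
- move=> n B mB; have [mM _] := bMpast n.
  by have := mM measurableT B mB; rewrite setTI.
- by move=> n; exact: bmeas_integrable.
- move=> n; split=> [B mB|A GA].
    have [/measurable_EFinP mM _] := bMpast n.
    by have := mM measurableT B mB; rewrite setTI.
  have mA := past_T GA.
  rewrite /= !set_integral_indic//; congr (_%:E).
  by rewrite (partial_mean_orthogonal indX XD bF (leqnSn n) (bmeas_indic_past GA)).
Qed.

(** The squared gains of the resets serve as the variables [U k] of the
    martingale inequality, by [increment_sqr_le] with indicators as weights. *)
Lemma kesten_of_coordinates (c1 c2 c B C1 C2 s0 : R) : kesten_inequality c1 c2 ->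
  D c -> 0 <= B ->
  (forall k x y, (k < m)%N -> (forall i, D (x i)) -> (forall i, D (y i)) ->
    (forall i, rho i != k -> x i = y i) -> `|F x - F y| <= B) ->
  0 < C1 -> 0 < C2 -> expR 2 * B ^+ 2 <= s0 ->
  (forall s, s0 <= s ->
    (P [set w | (s < \sum_(k < m) (F (Xs w) - F (reset rho k c (Xs w))) ^+ 2)%R] <=
     (C1 * expR (- C2 * s ^+ 2))%:E)%E) ->
  forall s, 0 < s ->
    (P [set w | (s < `|F (Xs w) - EF|)%R] <=
     (c1 * (1 + C1 + C1 / (s0 ^+ 2 * C2)) *
      expR (- c2 * (s / (s0 `^ 2^-1 + (s / (s0 * C2)) `^ 3^-1))))%:E)%E.
Proof.
move=> kes Dc B0 FB C10 C20 s0B tail s s_gt0.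
have bR k := bcoord_reset rho k Dc bF.
pose u k w := (F (Xs w) - F (reset rho k c (Xs w))) ^+ 2.
have bu k : bmeas (u k).
  by apply: bmeasX; apply: bmeasB => //; exact: (bcoord_bmeasX XD (bR k)).
have u_ge0 k w : 0 <= u k w by exact: sqr_ge0.
have u0 k w : (m <= k)%N -> u k w = 0.
  move=> mk; rewrite /u (_ : F (reset rho k c (Xs w)) = F (Xs w)) ?subrr ?expr0n//.
  apply: lF => i im; rewrite /reset; case: eqP => // ik.
  by move: im; rewrite ik ltnNge mk.
have muk k : measurable_fun setT (u k.-1) by case: (bu k.-1).
have mXs : measurable_fun setT (fun w => F (Xs w)) by case: bXs.
pose U k : {RV P >-> R} := mfun_Sub (mem_set (muk k)).
pose Minf : {RV P >-> R} := mfun_Sub (mem_set mXs).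
have MkE k w : (m <= k)%N -> M k w = F (Xs w).
  by move=> mk; exact: partial_mean_local lF mk.
have sumU w : (\sum_(1 <= k <oo) (U k w)%:E)%E = (\sum_(k < m) u k w)%:E.
  apply/cvg_lim => //; rewrite -(cvg_shiftn m.+1)/=.
  rewrite (_ : (fun n => _) = fun=> (\sum_(k < m) u k w)%:E); first exact: cvg_cst.
  apply/funext => n; rewrite sumEFin; congr (_%:E).
  rewrite addnS big_add1 /= (big_cat_nat _ (n := m))//=; last exact: leq_addl.
  rewrite [X in _ + X]big_nat_cond [X in _ + X]big1 ?addr0; last first.
    by move=> k /andP[/andP[mk _] _]; exact: u0.
  by rewrite big_mkord.
apply: (kes disp T P (fun k => pastG k) M U Minf B C1 C2 s0) => //.
- exact: past_filtration.
- exact: partial_mean_martingale.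
- move=> [//|k] _; apply: aeW => w /=.
  have [km|mk] := ltnP k m.
    exact: (bounded_increment FB w km).
  by rewrite !MkE ?subrr ?normr0// (leq_trans mk).
- by move=> k w _; exact: u_ge0.
- move=> [//|k] _ Y Z /=; apply: ae_is_cond_exp_le => //.
  + exact: past_measurable.
  + by apply: bmeasX; exact: bmeasB.
  + by move=> w; exact: sqr_ge0.
  + move=> A GA; have mA := past_T GA.
    rewrite !set_integral_indic//; last by apply: bmeasX; exact: bmeasB.
    rewrite lee_fin; apply: (increment_sqr_le indX XD bF Dc (bmeas_indic_past GA)).
    by move=> w; rewrite indicE.
- move=> s' ss'; under eq_set do rewrite sumU lte_fin; exact: tail.
- apply: aeW => w /=; rewrite -(cvg_shiftn m)/=.
  rewrite (_ : (fun n => _) = fun=> F (Xs w)); first exact: cvg_cst.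
  by apply/funext => n; rewrite MkE// leq_addl.
Qed.

End martingale_inequalities.

Section bounded_differences_tail.
Context {R : realType} {disp : measure_display} {T : measurableType disp}.
Variable P : probability T R.
Context {I : choiceType}.
Variable X : I -> {RV P >-> R}.
Variable rho : I -> nat.
Variable D : set R.
Hypothesis indX : mutual_independence X.
Hypothesis XD : forall i w, D (X i w).
Variable F : (I -> R) -> R.
Hypothesis bF : bcoord D F.
Variable m : nat.
Hypothesis lF : rank_local rho m F.
Variable B : R.
Hypothesis FB : forall k x y, (k < m)%N -> (forall i, D (x i)) ->
  (forall i, D (y i)) -> (forall i, rho i != k -> x i = y i) -> `|F x - F y| <= B.

Local Notation Xs w := (fun i => X i w).
Local Notation EF := (\int[P]_w F (fun i => X i w)).

Lemma bounded_differences_tail (l r : R) : 0 <= l ->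
  (P [set w | (r <= `|F (Xs w) - EF|)%R] <=
   (2 * expR (m%:R * (2 * l ^+ 2 * B ^+ 2) - l * r))%:E)%E.
Proof.
move=> l0.
have bXs : bmeas (fun w => F (Xs w)) by exact: bcoord_bmeasX bF.
have EN : \int[P]_w (- F (Xs w)) = - EF.
  rewrite -[RHS]mulN1r -meanZ//.
  by apply: eq_Rintegral => w _; rewrite mulN1r.
have b0 : bcoord D (fun _ : I -> R => 0 : R).
  split; last by exists 0 => x _; rewrite normr0.
  by move=> d' S g _ _; exact: measurable_cst.
have bN : bcoord D (fun x => - F x).
  rewrite (_ : (fun x => - F x) = (fun x => 0 - F x)).
    exact: (bcoordB b0 bF).
  by apply/funext => x; rewrite sub0r.
have lN : rank_local rho m (fun x => - F x) by move=> x y xy; rewrite (lF xy).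
have NB k x y : (k < m)%N -> (forall i, D (x i)) -> (forall i, D (y i)) ->
    (forall i, rho i != k -> x i = y i) -> `|- F x - - F y| <= B.
  by move=> km xD yD xy; rewrite -opprD normrN; exact: FB km xD yD xy.
have up := bounded_differences_upper_tail indX XD bF lF FB r l0.
have := bounded_differences_upper_tail indX XD bN lN NB r l0.
rewrite EN => down.
have msets (f : T -> R) : bmeas f -> measurable [set w | r <= f w].
  move=> [mf _]; rewrite -[X in measurable X]setTI; exact: measurable_fun_le.
have bc : bmeas (fun _ : T => EF) by exact: bmeas_cst.
have m1 := msets _ (bmeasB bXs bc).
have m2 := msets _ (bmeasB (bmeasN bXs) (bmeasN bc)).
rewrite mulr_natl mulr2n EFinD; apply: le_trans (leeD up down).
apply: le_trans (measureU2 _ m1 m2); apply: le_measure.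
- rewrite inE; apply: (msets (fun w => `|F (Xs w) - EF|)).
  have [mf [C fC]] := bmeasB bXs bc.
  by split; [exact: measurableT_comp|exists C => w; rewrite normr_id].
- by rewrite inE; exact: measurableU.
- move=> w /= rw; have [F0|F0] := leP 0 (F (Xs w) - EF).
    by left; rewrite -(ger0_norm F0).
  by right; rewrite -opprD -(ltr0_norm F0).
Qed.

End bounded_differences_tail.


(** * Infima of linear functions of the conductances *)

Lemma sumr_const_list (R : realType) (I : Type) (E : seq I) (c : R) :
  \sum_(i <- E) c = (size E)%:R * c.
Proof.
elim: E => [|i E IHE]; first by rewrite big_nil mul0r.
by rewrite big_cons IHE /= mulrS mulrDl mul1r.
Qed.

(** The infimum is taken over a set of nonnegative profiles [p], of which [h]
    bounds one uniformly and [L] may be assumed to bound all.  Potentials enter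
    through their dissipation profiles only. *)
Section least_energy.
Context {R : realType} {I : choiceType}.
Variables (E : seq I) (prof : set (I -> R)) (L kappa h : R).
Hypothesis uniqE : uniq E.
Hypothesis kappa0 : 0 < kappa.
Hypothesis prof_ge0 : forall p i, prof p -> 0 <= p i.
Hypothesis prof_flat : exists2 p, prof p & forall i, p i <= h.
Hypothesis prof_trunc : forall p, prof p ->
  exists2 q, prof q & forall i, q i <= p i /\ q i <= L.

Definition least_energy (x : I -> R) : R :=
  inf [set \sum_(i <- E) x i * p i | p in prof].

Definition conductances := [set r : R | 0 < r <= kappa].
Local Notation D := conductances.
Local Notation Phi := least_energy.
Implicit Types (x y p : I -> R).

Let kappa_ge0 : 0 <= kappa. Proof. exact: ltW. Qed.

Let nonempty_energies x : [set \sum_(i <- E) x i * p i | p in prof] !=set0.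
Proof.
by have [p pp _] := prof_flat; exists (\sum_(i <- E) x i * p i); exists p.
Qed.

Let L_ge0 (i : I) : 0 <= L.
Proof.
have [p pp _] := prof_flat; have [q qq /(_ i)[_]] := prof_trunc pp.
by apply: le_trans; exact: prof_ge0.
Qed.

Lemma least_energy_le x p : (forall i, i \in E -> 0 <= x i) -> prof p ->
  Phi x <= \sum_(i <- E) x i * p i.
Proof.
move=> x0 pp; apply: ge_inf; last by exists p.
exists 0 => _ [q qq <-]; rewrite big_seq; apply: sumr_ge0 => i iE.
by rewrite mulr_ge0 ?x0 ?prof_ge0.
Qed.

Lemma least_energy_ge x c :
  (forall p, prof p -> c <= \sum_(i <- E) x i * p i) -> c <= Phi x.
Proof. by move=> cp; apply: lb_le_inf => // _ [p pp <-]; exact: cp. Qed.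

Lemma least_energy_lt x c : (forall i, i \in E -> 0 <= x i) -> Phi x < c ->
  exists p, [/\ prof p, forall i, p i <= L & \sum_(i <- E) x i * p i < c].
Proof.
move=> x0 /inf_lt [//|_ [p pp <-] pc].
have [q qq qp] := prof_trunc pp; exists q; split=> // [i|]; first by case: (qp i).
apply: le_lt_trans pc; rewrite big_seq [leRHS]big_seq; apply: ler_sum => i iE.
by rewrite ler_wpM2l ?x0//; case: (qp i).
Qed.

Lemma least_energy_ge0 x : (forall i, i \in E -> 0 <= x i) -> 0 <= Phi x.
Proof.
move=> x0; apply: least_energy_ge => p pp; rewrite big_seq; apply: sumr_ge0 => i iE.
by rewrite mulr_ge0 ?x0 ?prof_ge0.
Qed.

Lemma least_energy_mono x y : (forall i, i \in E -> 0 <= x i <= y i) ->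
  Phi x <= Phi y.
Proof.
move=> xy; apply: least_energy_ge => p pp.
apply: (@le_trans _ _ (\sum_(i <- E) x i * p i)).
  by apply: least_energy_le => // i /xy/andP[].
rewrite big_seq [leRHS]big_seq; apply: ler_sum => i /xy/andP[_ xyi].
by rewrite ler_wpM2r ?prof_ge0.
Qed.

Lemma least_energy_bound x : (forall i, D (x i)) ->
  0 <= Phi x <= (size E)%:R * (kappa * h).
Proof.
move=> xD; have x0 i : i \in E -> 0 <= x i by case/andP: (xD i) => /ltW.
rewrite least_energy_ge0//=; have [p pp ph] := prof_flat.
apply: (le_trans (least_energy_le x0 pp)).
rewrite -sumr_const_list; apply: ler_sum => i _.
by case/andP: (xD i) => /ltW xi xik; exact: ler_pM xi (prof_ge0 i pp) xik (ph i).
Qed.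

Lemma rank_local_least_energy : rank_local (index^~ E) (size E) Phi.
Proof.
move=> x y xy; rewrite /least_energy; congr inf; apply: eq_imagel => p _.
by apply: eq_big_seq => i iE; rewrite xy// index_mem.
Qed.

(** Upper semicontinuity from above: a near-minimizing profile for [x] stays so
    for slightly larger rational conductances. *)
Lemma least_energy_rational x c : (forall i, D (x i)) -> Phi x < c ->
  exists r : seq rat, (forall i, i \in E -> x i <= ratr (nth 0 r (index i E))) /\
    Phi (fun i => ratr (nth 0 r (index i E))) < c.
Proof.
move=> xD; have x0 i : i \in E -> 0 <= x i by case/andP: (xD i) => /ltW.
move=> /(least_energy_lt x0)[p [pp _ pe]].
pose S := \sum_(i <- E) p i.
have S0 : 0 <= S by apply: sumr_ge0 => i _; exact: prof_ge0.
set A := \sum_(i <- E) x i * p i in pe.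
pose eta := (c - A) / (S + 1).
have S1 : 0 < S + 1 by rewrite ltr_wpDl.
have eta0 : 0 < eta by rewrite divr_gt0// subr_gt0.
have qx i : {q : rat | x i < ratr q < x i + eta}.
  apply: cid; have [|q] := @rat_in_itvoo R (x i) (x i + eta); first by rewrite ltrDl.
  by rewrite in_itv /=; exists q.
pose q i := sval (qx i).
have qE i : i \in E -> nth 0 (map q E) (index i E) = q i.
  by move=> iE; rewrite (nth_map i) ?index_mem// nth_index.
exists (map q E); split.
  by move=> i iE; rewrite qE// /q; case: (qx i) => /= r /andP[/ltW].
have q0 i : i \in E -> 0 <= (ratr (nth 0 (map q E) (index i E)) : R).
  move=> iE; rewrite qE// /q; case: (qx i) => /= r /andP[/ltW + _].
  exact: le_trans (x0 i iE).
apply: (le_lt_trans (least_energy_le q0 pp)).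
apply: (@le_lt_trans _ _ (A + eta * S)).
  rewrite /A /S mulr_sumr -big_split /= big_seq [leRHS]big_seq; apply: ler_sum => i iE.
  rewrite -mulrDl ler_wpM2r ?prof_ge0// qE// /q.
  by case: (qx i) => /= r /andP[_ /ltW].
by rewrite -ltrBrDl /eta mulrAC ltr_pdivrMr// ltr_pM2l ?subr_gt0// ltrDl.
Qed.

(** The energy is nondecreasing in the conductances, so [Phi x < c] holds if and
    only if [x] lies below some rational family of conductances where it holds:
    a countable union of boxes. *)
Lemma bcoord_least_energy : bcoord D Phi.
Proof.
split; last first.
  exists ((size E)%:R * (kappa * h)) => x xD.
  by have /andP[P0 ?] := least_energy_bound xD; rewrite ger0_norm.
move=> dS S g mg gD mT; apply: (measurability _ (RGenInftyO.measurableE R)) => //.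
move=> _ [_ [c ->] <-]; rewrite setTI.
pose y (r : seq rat) i : R := ratr (nth 0 r (index i E)).
pose A (r : seq rat) := if Phi (y r) < c
  then \big[setI/setT]_(i <- E) [set s | g i s <= y r i] else set0.
rewrite (_ : _ @^-1` _ = \bigcup_r A r).
  apply: countable_bigcupT_measurable => // r; rewrite /A; case: ifP => // _.
  apply: bigsetI_measurable => i _; rewrite -[X in measurable X]setTI.
  by apply: measurable_fun_le => //; exact: measurable_cst.
apply/seteqP; split=> s; rewrite /= in_itv /=.
  move=> /(least_energy_rational (fun i => gD i s))[r [gr Pr]].
  exists r => //; rewrite /A /y Pr -bigcap_seq => i /= iE; exact: gr.
move=> [r _]; rewrite /A; case: ifP => // Pr; rewrite -bigcap_seq => gr.
apply: le_lt_trans Pr; apply: least_energy_mono => i iE.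
by rewrite (gr i iE) andbT; case/andP: (gD i s) => /ltW.
Qed.

Section single_change.
Variable i0 : I.
Local Notation e k := (nth i0 E k).

(** Linearity in the conductances, of which only the [k]-th changes. *)
Lemma energy_single_change x y p k : (k < size E)%N ->
  (forall i, index i E != k -> x i = y i) ->
  \sum_(i <- E) y i * p i = \sum_(i <- E) x i * p i + (y (e k) - x (e k)) * p (e k).
Proof.
move=> km xy; have ekE : e k \in E by exact: mem_nth.
rewrite (bigD1_seq (e k))//= [X in _ = X + _](bigD1_seq (e k))//=.
rewrite [X in _ + X = _](eq_bigr (fun i => x i * p i)); last first.
  move=> i ik; have [iE|iE] := boolP (i \in E); last first.
    by rewrite xy// neq_ltn [X in _ || X](leq_trans km)// ?orbT// leqNgt index_mem.
  by rewrite xy//; apply: contraNN ik => /eqP <-; rewrite nth_index.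
ring.
Qed.

Lemma least_energy_single_change x y k : (k < size E)%N ->
  (forall i, D (x i)) -> (forall i, D (y i)) ->
  (forall i, index i E != k -> x i = y i) -> `|Phi x - Phi y| <= kappa * L.
Proof.
move=> km.
have half u v : (forall i, D (u i)) -> (forall i, D (v i)) ->
    (forall i, index i E != k -> u i = v i) -> Phi v <= Phi u + kappa * L.
  move=> uD vD uv; apply/ler_addgt0Pr => eta eta0.
  have u0 i : i \in E -> 0 <= u i by case/andP: (uD i) => /ltW.
  have v0 i : i \in E -> 0 <= v i by case/andP: (vD i) => /ltW.
  have [|p [pp pL pe]] := @least_energy_lt u (Phi u + eta) u0; first by rewrite ltrDl.
  apply: (le_trans (least_energy_le v0 pp)); rewrite (energy_single_change p km uv).
  rewrite addrAC; apply: lerD; first exact: ltW.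
  have /andP[ue _] := uD (e k); have /andP[_ ve] := vD (e k).
  apply: (@le_trans _ _ (kappa * p (e k))); last by rewrite ler_wpM2l.
  by rewrite ler_wpM2r ?prof_ge0//; lra.
move=> xD yD xy; rewrite ler_distl; apply/andP; split.
  by rewrite lerBlDr; apply: half => // i ik; rewrite xy.
by apply: half => // i ik; rewrite xy.
Qed.

Section reset.
Variables (x : I -> R) (eps : R).
Hypothesis xD : forall i, D (x i).
Local Notation gain k := (Phi x - Phi (reset (index^~ E) k kappa x)).

Let x0 i : i \in E -> 0 <= x i. Proof. by case/andP: (xD i) => /ltW. Qed.

Let resetD k i : D (reset (index^~ E) k kappa x i).
Proof. by rewrite /reset; case: ifP => // _; rewrite /D/= kappa0 lexx. Qed.

Lemma gain_sqr_le k : (k < size E)%N -> gain k ^+ 2 <= (kappa * L) ^+ 2.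
Proof.
move=> km; rewrite -[leLHS]real_normK ?num_real// lerXn2r ?nnegrE//.
  by rewrite mulr_ge0// (L_ge0 i0).
apply: least_energy_single_change km _ _ _ => //.
by move=> i; rewrite /reset => /negbTE ->.
Qed.

Lemma sum_gain_sqr_le_trivial :
  \sum_(k < size E) gain k ^+ 2 <= (size E)%:R * (kappa * L) ^+ 2.
Proof.
have -> : (size E)%:R * (kappa * L) ^+ 2 = \sum_(k < size E) (kappa * L) ^+ 2.
  by rewrite sumr_const card_ord mulr_natl.
by apply: ler_sum => k _; exact: gain_sqr_le.
Qed.

(** Each squared gain is at most [kappa * L] times the gain, and one
    near-minimizing profile [p] for [x] bounds all gains by [kappa * p].  Where
    [x i >= eps], [p i] is at most [x i * p i / eps], and these add up to nearly
    [Phi x / eps]. *)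
Lemma sum_gain_sqr_le : 0 < eps ->
  \sum_(k < size E) gain k ^+ 2 <=
  kappa ^+ 2 * L * (Phi x / eps + L * \sum_(i <- E) (x i < eps)%R%:R).
Proof.
move=> eps0; have L0 := L_ge0 i0; apply/ler_addgt0Pr => t t0.
pose m : R := (size E)%:R; have m0 : 0 <= m by rewrite ler0n.
(* the total error when p is within eta of the infimum is eta * (C - 1) *)
pose C := kappa * L * (kappa / eps + m) + 1.
have C0 : 0 < C.
  by rewrite ltr_wpDl// mulr_ge0 ?mulr_ge0 ?addr_ge0 ?divr_ge0 ?(ltW eps0).
pose eta := t / C; have eta0 : 0 < eta by rewrite divr_gt0.
have [|p [pp pL pe]] := @least_energy_lt x (Phi x + eta) x0; first by rewrite ltrDl.
have gk (k : 'I_(size E)) : gain k ^+ 2 <= kappa * L *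
    (kappa * (x (e k) * p (e k) / eps + L * (x (e k) < eps)%R%:R) + eta).
  have km := ltn_ord k.
  have mono : Phi x <= Phi (reset (index^~ E) k kappa x).
    apply: least_energy_mono => i iE; rewrite x0//= /reset; case: ifP => // _.
    by case/andP: (xD i).
  have g0 : 0 <= - gain k by rewrite opprB subr_ge0.
  have xyE i : index i E != k -> x i = reset (index^~ E) k kappa x i.
    by move=> /negbTE ik; rewrite /reset ik.
  have gL : - gain k <= kappa * L.
    have := least_energy_single_change km xD (resetD k) xyE.
    by apply: le_trans; rewrite -normrN ler_norm.
  have y0 i : i \in E -> 0 <= reset (index^~ E) k kappa x i.
    by move=> _; case/andP: (resetD k i) => /ltW.
  have gp : - gain k <= kappa * p (e k) + eta.
    rewrite opprB lerBlDr; apply: (le_trans (least_energy_le y0 pp)).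
    rewrite (energy_single_change p km xyE) /reset index_uniq// eqxx.
    have := prof_ge0 (e k) pp; case/andP: (xD (e k)) => xe _ pe0.
    have := mulr_ge0 (ltW xe) pe0; lra.
  have pbound : p (e k) <= x (e k) * p (e k) / eps + L * (x (e k) < eps)%R%:R.
    have pe0 := prof_ge0 (e k) pp; case/andP: (xD (e k)) => xe _.
    have [xeps|xeps] := ltP (x (e k)) eps.
      rewrite mulr1 (le_trans (pL _))// lerDr divr_ge0 ?(ltW eps0)//.
      by rewrite mulr_ge0// ltW.
    by rewrite mulr0 addr0 ler_pdivlMr// mulrC ler_wpM2r.
  rewrite -sqrrN expr2; apply: ler_pM => //; apply: (le_trans gp).
  by rewrite lerD2r ler_wpM2l.
apply: (le_trans (ler_sum _ (fun k _ => gk k))).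
rewrite -mulr_sumr big_split/= -mulr_sumr big_split /= -mulr_suml -mulr_sumr.
have sumE (G : I -> R) : \sum_(k < size E) G (e k) = \sum_(i <- E) G i.
  by rewrite (big_nth i0) big_mkord.
rewrite (sumE (fun i => x i * p i)) (sumE (fun i => (x i < eps)%R%:R)).
rewrite sumr_const card_ord -mulr_natr -/m.
set bad := \sum_(i <- E) _; set S := \sum_(i <- E) _ in pe *.
have tE : t = eta * C by rewrite /eta divfK// gt_eqF.
rewrite tE /C.
have Se : S / eps <= Phi x / eps + eta / eps.
  by rewrite -mulrDl ler_wpM2r ?invr_ge0 ?(ltW eps0)// ltW.
have kL : 0 <= kappa ^+ 2 * L by rewrite mulr_ge0 ?sqr_ge0.
have := ler_wpM2l kL Se; rewrite expr2.
set A := S / eps; set B := Phi x / eps; set ie := eps^-1; nra.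
Qed.

End reset.
End single_change.
End least_energy.

(** * The effective conductance of a box *)

Section box_edges.
Variables (d : nat) (hd : (0 < d)%N) (N : nat).

Definition box_edge_seq : seq (edge d) :=
  finmap.enum_fset (fset_set (@box_edges d N)).

Lemma mem_box_edge_seq e : (e \in box_edge_seq) =
  (box N (src e) && cbox N (tgt e)) || (box N (tgt e) && cbox N (src e)).
Proof.
rewrite -[LHS]/(e \in fset_set (@box_edges d N)) in_fset_set; last exact: finite_box_edges.
by apply/idP/idP => [/set_mem//|He]; exact: mem_set.
Qed.

(** Every edge has its source or its target in the box. *)
Lemma size_box_edge_seq : (size box_edge_seq <= 2 * d * N ^ d)%N.
Proof.
pose shift (p : {ffun 'I_d -> 'I_N}) : Zd d := [ffun j => ((p j).+1)%:Z].
pose g (t : bool * {ffun 'I_d -> 'I_N} * 'I_d) : edge d :=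
  (if t.1.1 then shift t.1.2 else shift t.1.2 - unit_vec t.2, t.2).
have boxP (x : Zd d) : box N x -> exists p, shift p = x.
  move=> /forallP xN.
  have lt j : (`|x j|%N.-1 < N)%N by have := xN j; lia.
  exists [ffun j => Ordinal (lt j)]; apply/ffunP => j; rewrite !ffunE /=.
  by have := xN j; lia.
have -> : (2 * d * N ^ d)%N = size (codom g).
  by rewrite size_codom !card_prod card_bool card_ffun !card_ord mulnAC.
apply: uniq_leq_size; first exact: finmap.fset_uniq.
move=> [x i]; rewrite mem_box_edge_seq => /orP[] /andP[/boxP[p]].
  rewrite /src /= => <- _; apply/codomP.
  by exists (true, p, i).
rewrite /tgt /= => px _; apply/codomP; exists (false, p, i).
by rewrite /g /= px addrK.
Qed.

(** Two differing coordinates would make the squared distance at least [2]. *)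
Lemma adj_coord (x y : Zd d) i j : adj x y -> x j != y j -> i != j -> x i = y i.
Proof.
move=> /eqP xy xyj ij; apply/eqP; apply: contraT => xyi.
move: xy; rewrite (bigD1 j)//= (bigD1 i)//=.
have : 0 <= \sum_(k < d | (k != j) && (k != i)) (x k - y k) ^+ 2.
  by apply: sumr_ge0 => k _; exact: sqr_ge0.
have sqr1 (z : int) : z != 0 -> 1 <= z ^+ 2.
  by move=> z0; rewrite -gtz0_ge1 lt0r sqrf_eq0 z0 sqr_ge0.
have := sqr1 (x i - y i); have := sqr1 (x j - y j); rewrite !subr_eq0 xyi xyj.
move=> /(_ isT) + /(_ isT); set s := \sum_(k < d | _) _.
move: ((x j - y j) ^+ 2) ((x i - y i) ^+ 2) s => a b s; lia.
Qed.

Section potentials.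
Context {R : realType}.

Definition dissipation (u : Zd d -> R) (e : edge d) : R :=
  N%:R ^- d * (u (src e) - u (tgt e)) ^+ 2.

Definition dissipations := [set dissipation u | u in admissible hd N].

(** A lateral boundary point leaves the box through a coordinate other than the
    first, the only one in which it differs from its neighbour. *)
Lemma admissible_coord1 : admissible hd N (fun x => (coord1 hd x)%:~R : R).
Proof.
split=> [x _ ->//|x _ ->//|x y xy bx x0 xN yN].
suff -> : coord1 hd x = coord1 hd y by [].
move: bx; rewrite /bdry => /andP[/forallP xc]; rewrite negb_forall => /existsP[j xj].
have yj := forallP yN j; have xcj := xc j.
apply: (adj_coord (j := j) xy); first lia.
apply/eqP => ji; move: x0 xN; rewrite /coord1 ji; lia.
Qed.

Let clip (r : R) := Num.min (Num.max r 0) N.+1%:R.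

Lemma admissible_clip u : admissible hd N u -> admissible hd N (clip \o u).
Proof.
move=> [u0 uN ul]; split=> [x bx x0|x bx xN|x y xy bx x0 xN yN] /=.
- by rewrite u0// /clip maxxx min_l.
- by rewrite uN// /clip max_l// minxx.
- by rewrite (ul x y).
Qed.

Lemma dissipation_ge0 p e : dissipations p -> 0 <= p e.
Proof.
by move=> [u _ <-]; rewrite /dissipation mulr_ge0 ?sqr_ge0// invr_ge0 exprn_ge0.
Qed.

Lemma flat_dissipation : exists2 p, dissipations p & forall e, p e <= N%:R ^- d.
Proof.
exists (dissipation (fun x => (coord1 hd x)%:~R)).
  by exists (fun x => (coord1 hd x)%:~R) => //; exact: admissible_coord1.
move=> e; rewrite /dissipation ler_piMr ?invr_ge0 ?exprn_ge0//.
rewrite /src /tgt /coord1 !ffunE -intrB opprD addNKr rmorphN sqrrN.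
by case: (_ == _); rewrite ?expr0n ?expr1n.
Qed.

(** Truncation to [[0, N + 1]] is 1-Lipschitz. *)
Lemma truncated_dissipation p : dissipations p -> exists2 q, dissipations q &
  forall e, q e <= p e /\ q e <= N%:R ^- d * N.+1%:R ^+ 2.
Proof.
move=> [u au <-]; exists (dissipation (clip \o u)).
  by exists (clip \o u) => //; exact: admissible_clip.
have N1 : 0 <= N.+1%:R :> R by [].
have clip0 r : 0 <= clip r <= N.+1%:R.
  by rewrite /clip le_min N1 le_max lexx orbT ge_min lexx orbT.
have abs2 (r s : R) : - `|r - s| <= r - s <= `|r - s|.
  by rewrite -ler_norml lexx.
have minL (n r s : R) : `|Num.min r n - Num.min s n| <= `|r - s|.
  have := abs2 r s; rewrite ler_norml !minElt.
  by case: (ltP r n) => ?; case: (ltP s n) => ? /andP[? ?]; lra.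
have maxL (n r s : R) : `|Num.max r n - Num.max s n| <= `|r - s|.
  have := abs2 r s; rewrite ler_norml !maxElt.
  by case: (ltP r n) => ?; case: (ltP s n) => ? /andP[? ?]; lra.
have clipL r s : `|clip r - clip s| <= `|r - s|.
  exact: le_trans (minL _ _ _) (maxL _ _ _).
move=> e; have c0 : 0 <= N%:R ^- d :> R by rewrite invr_ge0 exprn_ge0.
split; apply: ler_wpM2l => //=.
  by rewrite -[leLHS]real_normK ?num_real// -[leRHS]real_normK ?num_real// lerXn2r ?nnegrE.
have /andP[s0 s1] := clip0 (u (src e)); have /andP[t0 t1] := clip0 (u (tgt e)).
by rewrite -[leLHS]real_normK ?num_real// lerXn2r ?nnegrE// ler_norml; lra.
Qed.

Lemma inf_scale (S : set R) (c : R) : 0 < c -> has_inf S ->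
  c * inf S = inf [set c * r | r in S].
Proof.
move=> c0 [S0 lS]; apply/eqP; rewrite eq_le; apply/andP; split.
  apply: lb_le_inf; first by case: S0 => r Sr; exists (c * r), r.
  by move=> _ [r Sr <-]; rewrite ler_pM2l//; exact: ge_inf.
rewrite -ler_pdivrMl//; apply: lb_le_inf => // r Sr.
rewrite ler_pdivrMl//; apply: ge_inf; last by exists r.
by case: lS => b bS; exists (c * b) => _ [s Ss <-]; rewrite ler_pM2l//; exact: bS.
Qed.

Lemma eff_condE (x : edge d -> R) : (0 < N)%N -> (forall e, 0 < x e) ->
  eff_cond hd x N = least_energy box_edge_seq dissipations x.
Proof.
move=> N0 x0; rewrite /eff_cond inf_scale; last 2 first.
- by rewrite invr_gt0 exprn_gt0// ltr0n.
- split; first by exists (energy x N (fun y => (coord1 hd y)%:~R) (fun y => (coord1 hd y)%:~R)),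
    (fun y => (coord1 hd y)%:~R) => //; exact: admissible_coord1.
  exists 0 => _ [u _ <-]; rewrite /energy fsbig_finite/=; last exact: finite_box_edges.
  by apply: sumr_ge0 => e _; rewrite -mulrA mulr_ge0 ?(ltW (x0 e))// -expr2 sqr_ge0.
have E u : N%:R ^- d * energy x N u u = \sum_(e <- box_edge_seq) x e * dissipation u e.
  rewrite /energy fsbig_finite/=; last exact: finite_box_edges.
  by rewrite mulr_sumr; apply: eq_bigr => e _; rewrite /dissipation expr2; ring.
rewrite /least_energy; congr inf; apply/seteqP; split=> r /=.
  by move=> [_ [u au <-] <-]; exists (dissipation u); [exists u|rewrite -E].
by move=> [_ [u au <-] <-]; rewrite -E; exists (energy x N u u) => //; exists u.
Qed.

End potentials.
End box_edges.

(** * Fluctuations of the effective conductance *)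

Section real_estimates.
Context {R : realType}.

Lemma expR_half_le2 : expR (2^-1 : R) <= 2.
Proof.
rewrite -[X in expR X]opprK expRN -[leRHS]invrK lef_pV2 ?posrE ?expR_gt0 ?invr_gt0//.
by apply: le_trans (expR_ge1Dx _); lra.
Qed.

Lemma expR2_le12 : expR (2 : R) <= 12.
Proof.
have e4 : expR (4^-1 : R) <= 4 / 3.
  rewrite -[X in expR X]opprK expRN -[leRHS]invrK lef_pV2 ?posrE ?expR_gt0 ?invr_gt0//.
  by apply: le_trans (expR_ge1Dx _); lra.
have -> : (2 : R) = 8%:R * 4^-1 by lra.
rewrite expRM_natl; apply: (@le_trans _ _ ((4 / 3) ^+ 8)); last by lra.
by rewrite lerXn2r ?nnegrE ?expR_ge0//; lra.
Qed.

(** If half of the threshold [s] covers the mean [x + c * mb] of the bound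
    [x + c * b] on [g], the excess of [g] over [s] is due to [b - mb]. *)
Lemma centered_excess (x b mb g A s c : R) : 2 * A <= s -> s < g ->
  g <= x + c * b -> x + c * mb <= A -> s <= (b - mb) * (2 * c).
Proof.
move=> As sg gb mA; have -> : (b - mb) * (2 * c) = 2 * (c * b - c * mb) by ring.
lra.
Qed.

End real_estimates.

Lemma mem_set_bool (T : Type) (p : T -> bool) x : (x \in [set y | p y]) = p x.
Proof. by apply/idP/idP => [/set_mem|px]; [|exact: mem_set]. Qed.

Lemma measurable_ltr_cst (R : realType) (d : measure_display)
    (T : measurableType d) (g : T -> R) (c : R) :
  measurable_fun setT g -> measurable [set s | g s < c].
Proof.
by move=> mg; have := mg measurableT _ (measurable_itv `]-oo, c[); rewrite setTI set_itvE.
Qed.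

Lemma inv_tail_ge0 (R : realType) (disp : measure_display)
    (T : measurableType disp) (P : probability T R) (I : Type)
    (X : I -> {RV P >-> R}) (D0 gamma : R) : I -> inv_tail X D0 gamma -> 0 <= D0.
Proof.
move=> i tailD0; have := tailD0 i 1 (lexx 1); rewrite powR1 mulr1 -lee_fin.
exact: le_trans (measure_ge0 _ _).
Qed.

Section random_conductances.
Variables (R : realType) (d : nat) (hd : (0 < d)%N)
  (disp : measure_display) (T : measurableType disp) (P : probability T R)
  (a : edge d -> {RV P >-> R}) (kappa : R).
Hypothesis kappa1 : 1 <= kappa.
Hypothesis inda : mutual_independence a.
Hypothesis aD : forall (e : edge d) (w : T), 0 < a e w <= kappa.
Variable N : nat.
Hypothesis N1 : (1 <= N)%N.

Local Notation n := (N%:R : R).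
Local Notation nd := (N%:R ^+ d : R).
Local Notation dR := (d%:R : R).
Local Notation E := (@box_edge_seq d N).
Local Notation rho := (index^~ E).
Local Notation Phi := (@least_energy R _ E (dissipations hd N)).
Local Notation Xs w := (fun e => a e w).
Local Notation L := (N%:R ^- d * N.+1%:R ^+ 2 : R).
Local Notation f := (fun w => eff_cond hd (fun e => a e w) N).
Local Notation B := (4 * kappa * n ^+ 2 / nd).
Local Notation D := (conductances kappa).

Let n1 : 1 <= n. Proof. by rewrite (ler_nat _ 1). Qed.
Let n0 : 0 < n. Proof. exact: lt_le_trans n1. Qed.
Let nd0 : 0 < nd. Proof. exact: exprn_gt0. Qed.
Let kappa0 : 0 < kappa. Proof. exact: lt_le_trans kappa1. Qed.
Let uniqE : uniq E. Proof. exact: finmap.fset_uniq. Qed.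
Let i0 : edge d := (0, Ordinal hd).
Let kappaD : D kappa. Proof. by rewrite /conductances /= kappa0 lexx. Qed.

Let L_le : L <= 4 * n ^+ 2 / nd.
Proof.
rewrite mulrC ler_wpM2r ?invr_ge0 ?(ltW nd0)//.
have -> : (4 : R) * n ^+ 2 = (2 * n) ^+ 2 by rewrite exprMn; congr (_ * _); lra.
rewrite lerXn2r ?nnegrE ?mulr_ge0//.
by have := n1; rewrite -natr1; lra.
Qed.

Let L_ge0 : 0 <= L.
Proof. by rewrite mulr_ge0 ?sqr_ge0 ?invr_ge0// ltW. Qed.

Let size_le : (size E)%:R <= 2 * dR * nd.
Proof. by rewrite -natrX -!natrM ler_nat size_box_edge_seq. Qed.

Let fE w : eff_cond hd (fun e => a e w) N = Phi (Xs w).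
Proof. by apply: eff_condE => // e; case/andP: (aD e w). Qed.

Let flat := @flat_dissipation d hd N R.
Let trunc := @truncated_dissipation d hd N R.
Let diss0 := @dissipation_ge0 d hd N R.

Let bPhi : bcoord D Phi.
Proof. exact: (bcoord_least_energy E kappa diss0 flat trunc). Qed.

Let locPhi : rank_local rho (size E) Phi.
Proof. exact: rank_local_least_energy. Qed.

Let EfE : fine 'E_P[f] = \int[P]_w Phi (Xs w).
Proof. by rewrite unlock; congr fine; apply: eq_integral => w _; rewrite fE. Qed.

Let kL_le_B : kappa * L <= B.
Proof.
have -> : B = kappa * (4 * n ^+ 2 / nd) by ring.
by rewrite ler_wpM2l ?(ltW kappa0)//; exact: L_le.
Qed.

Let diffPhi k x y : (k < size E)%N -> (forall i, D (x i)) -> (forall i, D (y i)) ->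
  (forall i, index i E != k -> x i = y i) -> `|Phi x - Phi y| <= B.
Proof.
move=> km xD yD xy.
exact: le_trans (least_energy_single_change uniqE kappa0 diss0 flat trunc i0 km xD yD xy) kL_le_B.
Qed.

Let gains w := \sum_(k < size E) (Phi (Xs w) - Phi (reset rho k kappa (Xs w))) ^+ 2.

Let bgain k : bmeas (fun w => (Phi (Xs w) - Phi (reset rho k kappa (Xs w))) ^+ 2).
Proof.
apply: bmeasX; apply: bmeasB; first exact: bcoord_bmeasX bPhi.
exact: (bcoord_bmeasX aD (bcoord_reset rho k kappaD bPhi)).
Qed.

Let bgains : bmeas gains.
Proof. exact: bmeas_sum. Qed.

Lemma variance_eff_cond_le : ('V_P[f] <= (\int[P]_w gains w)%:E)%E.
Proof.
rewrite (_ : f = fun w => Phi (Xs w)); last by apply/funext => w; exact: fE.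
rewrite /gains mean_sum//.
exact: (variance_le_sum_reset inda aD bPhi locPhi kappaD).
Qed.

(** Every gain is at most [kappa * L]. *)
Lemma variance_eff_cond_trivial :
  ('V_P[f] <= (32 * dR * kappa ^+ 2 * (n ^+ 4 / nd))%:E)%E.
Proof.
apply: (le_trans variance_eff_cond_le); rewrite lee_fin.
rewrite -[leRHS](mean_cst P); apply: mean_le => //; first exact: bmeas_cst.
move=> w; apply: (@le_trans _ _ ((size E)%:R * (kappa * L) ^+ 2)).
  exact: (sum_gain_sqr_le_trivial uniqE kappa0 diss0 flat trunc i0 (fun e => aD e w)).
have B2 : (kappa * L) ^+ 2 <= B ^+ 2.
  by rewrite lerXn2r ?nnegrE ?mulr_ge0 ?invr_ge0 ?(ltW kappa0) ?(ltW nd0) ?sqr_ge0.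
apply: (le_trans (ler_pM _ _ size_le B2)) => //; first exact: sqr_ge0.
rewrite le_eqVlt; apply/orP; left; apply/eqP; by field; rewrite gt_eqF.
Qed.

(** The parameter [q] is the scale [N^((4 - d) / 2)], given by its square.  The
    exponent [l] of the moment is chosen so that the linear term is the announced
    one; the quadratic term is then at most [1/2], and [2 * expR (1/2) <= 4]. *)
Lemma tail_eff_cond (t q : R) : 0 < t -> 0 < q -> q ^+ 2 = n ^+ 4 / nd ->
  (P [set w | (t * q <= `|f w - fine 'E_P[f]|)%R] <=
   (4 * expR (- t / (8 * kappa * Num.sqrt (2 * d%:R))))%:E)%E.
Proof.
move=> t0 q0 q2; rewrite EfE.
under eq_set do rewrite fE.
have d0 : 0 < dR by rewrite ltr0n.
pose y := (8 * kappa * Num.sqrt (2 * dR))^-1.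
have sq0 : 0 < Num.sqrt (2 * dR) by rewrite sqrtr_gt0 mulr_gt0.
have y0 : 0 < y by rewrite invr_gt0 !mulr_gt0.
have y2 : y ^+ 2 = (128 * dR * kappa ^+ 2)^-1.
  rewrite /y exprVn !exprMn sqr_sqrtr; last by rewrite mulr_ge0// ltW.
  by congr (_^-1); ring.
have l0 : 0 <= y / q by rewrite divr_ge0// ltW.
apply: (le_trans (bounded_differences_tail inda aD bPhi locPhi diffPhi (t * q) l0)).
rewrite lee_fin.
have e1 : y / q * (t * q) = t * y by field; rewrite gt_eqF.
have e2 : (size E)%:R * (2 * (y / q) ^+ 2 * B ^+ 2) <= 2^-1.
  apply: (@le_trans _ _ (2 * dR * nd * (2 * (y / q) ^+ 2 * B ^+ 2))).
    apply: ler_wpM2r => //; apply: mulr_ge0 (sqr_ge0 _).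
    by apply: mulr_ge0 (sqr_ge0 _).
  rewrite expr_div_n y2 q2 le_eqVlt; apply/orP; left; apply/eqP.
  by field; rewrite !gt_eqF.
rewrite e1 expRB; apply: (@le_trans _ _ (2 * (2 * expR (- (t * y))))).
  rewrite ler_wpM2l// -expRN ler_wpM2r ?expR_ge0//.
  by apply: le_trans expR_half_le2; rewrite ler_expR.
by rewrite mulrA mulNr /y; apply: ler_wpM2r; rewrite ?expR_ge0//; lra.
Qed.

Section inverse_tail.
Variables (D0 gamma : R).
Hypothesis gamma02 : 0 < gamma < 2.
Hypothesis tailD0 : inv_tail a D0 gamma.

Local Notation G := (n `^ gamma).
Local Notation W := (G * n ^+ 2 / nd).
Local Notation C0 := (32 * dR * kappa ^+ 3).

Let G1 : 1 <= G.
Proof.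
have /andP[/ltW g0 _] := gamma02.
by have := ler_powR n1 g0; rewrite powRr0.
Qed.
Let G0 : 0 < G. Proof. exact: lt_le_trans G1. Qed.
Let W0 : 0 < W. Proof. by rewrite !mulr_gt0 ?invr_gt0 ?exprn_gt0. Qed.

Let D0_ge0 : 0 <= D0. Proof. exact: inv_tail_ge0 i0 tailD0. Qed.

(** The number of edges with conductance below [eps = N^-gamma]. *)
Let bad (x : edge d -> R) : R := \sum_(e <- E) (x e < G^-1)%R%:R.

Let bbad : bcoord D bad.
Proof.
split.
  move=> dS S g mg gD; rewrite /bad.
  have mi e : measurable_fun setT (fun s => (\1_[set r : R | r < G^-1] (g e s) : R)).
    have mI : measurable_fun setT (\1_[set r : R | r < G^-1] : R -> R).
      by apply: measurable_indic; apply: measurable_ltr_cst; exact: measurable_id.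
    exact: (measurableT_comp mI (mg e)).
  rewrite (_ : (fun s => _) = fun s => \sum_(e <- E) (\1_[set r : R | r < G^-1] (g e s) : R)).
    exact: measurable_sum.
  apply/funext => s; apply: eq_bigr => e _; rewrite indicE; congr (_%:R).
  by rewrite mem_set_bool.
exists (size E)%:R => x _; rewrite ger0_norm; last exact: sumr_ge0.
rewrite -[leRHS]mulr1 -sumr_const_list; apply: ler_sum => e _.
by case: (_ < _).
Qed.

Let locbad : rank_local rho (size E) bad.
Proof. by move=> x y xy; apply: eq_big_seq => e eE; rewrite xy// index_mem. Qed.

Let diffbad k (x y : edge d -> R) : (k < size E)%N -> (forall i, D (x i)) ->
  (forall i, D (y i)) -> (forall i, rho i != k -> x i = y i) -> `|bad x - bad y| <= 1.
Proof.
move=> km _ _ xy; pose ind (z : edge d -> R) e : R := (z e < G^-1)%R%:R.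
have badE z : bad z = \sum_(e <- E) ind z e * 1 by apply: eq_bigr => e _; rewrite mulr1.
have xyi i : rho i != k -> ind x i = ind y i by rewrite /ind => /xy ->.
rewrite !badE (energy_single_change uniqE i0 (fun=> 1) km xyi) mulr1 opprD addrA subrr sub0r normrN.
by rewrite /ind; do 2 case: (_ < _); rewrite ?subrr ?subr0 ?sub0r ?normrN ?normr0 ?normr1.
Qed.

Let bbadX : bmeas (fun w => bad (Xs w)).
Proof. exact: (bcoord_bmeasX aD bbad). Qed.

Let mean_bad : \int[P]_w bad (Xs w) <= 2 * dR * nd * (D0 * (G / n ^+ 2)).
Proof.
pose A e := [set w | a e w < G^-1].
have mA e : measurable (A e).
  exact: measurable_ltr_cst.
have badE w : bad (Xs w) = \sum_(e <- E) \1_(A e) w.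
  apply: eq_bigr => e _; rewrite indicE; congr (_%:R).
  by rewrite mem_set_bool.
under eq_Rintegral do rewrite badE.
rewrite mean_sum => [|e]; last exact: bmeas_indic.
have g0 : gamma != 0 by case/andP: gamma02 => /gt_eqF ->.
have GE : G `^ (1 - 2 / gamma) = G / n ^+ 2.
  rewrite -powRrM mulrBr mulr1 mulrCA mulfV// mulr1 powRB ?powR_mulrn ?(ltW n0)//.
  by apply/implyP => _; rewrite gt_eqF.
have PA e : \int[P]_w \1_(A e) w <= D0 * (G / n ^+ 2).
  rewrite -lee_fin -prob_indic// -GE; apply: le_trans (tailD0 e G1).
  have invE w : (G <= (a e w)^-1) = (a e w <= G^-1).
    have /andP[ae _] := aD e w.
    by rewrite -[in RHS](invrK (a e w)) lef_pV2 ?posrE ?invr_gt0.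
  under [X in (_ <= P X)%E]eq_set do rewrite invE.
  apply: le_measure; last by move=> w /= /ltW.
    by rewrite inE; exact: mA.
  by rewrite inE -[X in measurable X]setTI; exact: measurable_fun_le.
apply: (le_trans (ler_sum _ (fun e _ => PA e))).
rewrite sumr_const_list; apply: ler_wpM2r => //.
by rewrite !mulr_ge0 ?invr_ge0 ?(ltW G0) ?sqr_ge0.
Qed.

Let gains_le w :
  gains w <= 8 * dR * kappa ^+ 3 * W + 16 * kappa ^+ 2 * (n ^+ 4 / nd ^+ 2) * bad (Xs w).
Proof.
have Gi : 0 < G^-1 by rewrite invr_gt0.
have wD e : D (a e w) by exact: aD.
apply: (le_trans (sum_gain_sqr_le uniqE kappa0 diss0 flat trunc i0 wD Gi)).
rewrite invrK -/(bad (Xs w)).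
have bad0 : 0 <= bad (Xs w) by exact: sumr_ge0.
have /andP[Phi0 PhiL] := least_energy_bound E diss0 flat wD.
have Phi1 : Phi (Xs w) <= 2 * dR * kappa.
  apply: (le_trans PhiL); rewrite mulrCA mulrC ler_wpM2r ?(ltW kappa0)//.
  by rewrite ler_pdivrMr.
have Q0 : 0 <= 4 * n ^+ 2 / nd by rewrite !mulr_ge0 ?invr_ge0 ?(ltW nd0) ?sqr_ge0.
apply: (@le_trans _ _ (kappa ^+ 2 * (4 * n ^+ 2 / nd) *
   (2 * dR * kappa * G + (4 * n ^+ 2 / nd) * bad (Xs w)))).
  apply: ler_pM.
  - by rewrite mulr_ge0 ?sqr_ge0.
  - by rewrite addr_ge0 ?mulr_ge0// ltW.
  - by rewrite ler_wpM2l ?sqr_ge0.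
  - by apply: lerD; rewrite ler_wpM2r// ltW.
rewrite le_eqVlt; apply/orP; left; apply/eqP; by field; rewrite gt_eqF.
Qed.

Let scale_bad0 : 0 <= 16 * kappa ^+ 2 * (n ^+ 4 / nd ^+ 2).
Proof. by rewrite !mulr_ge0 ?invr_ge0 ?exprn_ge0 ?(ltW kappa0). Qed.

Let kappa23 : kappa ^+ 2 <= kappa ^+ 3.
Proof. by rewrite ler_weXn2l. Qed.

(** With the number of bad edges replaced by its mean, the bound on the squared
    gains is at most half the threshold [s0] of the martingale inequality. *)
Let mean_bound : 8 * dR * kappa ^+ 3 * W +
    16 * kappa ^+ 2 * (n ^+ 4 / nd ^+ 2) * \int[P]_w bad (Xs w) <= C0 * (D0 + 1) * W.
Proof.
apply: (@le_trans _ _ (8 * dR * kappa ^+ 3 * W +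
    16 * kappa ^+ 2 * (n ^+ 4 / nd ^+ 2) * (2 * dR * nd * (D0 * (G / n ^+ 2))))).
  by rewrite lerD2l ler_wpM2l.
have -> : 16 * kappa ^+ 2 * (n ^+ 4 / nd ^+ 2) * (2 * dR * nd * (D0 * (G / n ^+ 2))) =
    32 * dR * D0 * W * kappa ^+ 2.
  by field; rewrite !gt_eqF.
have c0 : 0 <= 32 * dR * D0 * W by rewrite !mulr_ge0 ?invr_ge0 ?(ltW nd0) ?sqr_ge0 ?(ltW G0).
have := ler_wpM2l c0 kappa23.
have : 0 <= dR * kappa ^+ 3 * W by rewrite !mulr_ge0 ?exprn_ge0 ?invr_ge0 ?(ltW nd0) ?(ltW G0) ?(ltW kappa0).
set U := W; set K := kappa ^+ 3; lra.
Qed.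

Lemma variance_eff_cond_inv_tail : ('V_P[f] <= (C0 * (D0 + 1) * W)%:E)%E.
Proof.
apply: (le_trans variance_eff_cond_le); rewrite lee_fin.
apply: le_trans mean_bound.
have bc c : bmeas (fun _ : T => c : R) by exact: bmeas_cst.
rewrite -[X in X + _](mean_cst P) -meanZ// -meanD//.
  by apply: mean_le => //; apply: bmeasD => //; exact: bmeasM.
exact: bmeasM.
Qed.

Local Notation s0 := (2 * C0 * (D0 + 1) * W).
Local Notation C2 := (nd ^+ 3 / (16 * C0 ^+ 2 * n ^+ 8)).

Let d1 : 1 <= dR. Proof. by rewrite (ler_nat _ 1). Qed.
Let d0 : 0 < dR. Proof. exact: lt_le_trans d1. Qed.
Let C0_gt0 : 0 < C0. Proof. by rewrite !mulr_gt0 ?exprn_gt0. Qed.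
Let D1 : 1 <= D0 + 1. Proof. by rewrite lerDr. Qed.

Let D1_gt0 : 0 < D0 + 1. Proof. exact: lt_le_trans D1. Qed.
Let s0_gt0 : 0 < s0. Proof. by rewrite (mulr_gt0 _ W0)// !mulr_gt0 ?exprn_gt0. Qed.

(** A large sum of squared gains forces the number of bad edges to exceed its
    mean, by [centered_excess], and that number has bounded differences. *)
Let tail_gains s : s0 <= s ->
  (P [set w | (s < gains w)%R] <= (1 * expR (- C2 * s ^+ 2))%:E)%E.
Proof.
move=> s0s; rewrite mul1r.
have s_gt0 : 0 < s by exact: lt_le_trans s0s.
pose c := 16 * kappa ^+ 2 * (n ^+ 4 / nd ^+ 2).
have c0 : 0 < c by rewrite /c !mulr_gt0 ?invr_gt0 ?exprn_gt0.
pose r := s / (2 * c); have r0 : 0 < r by rewrite divr_gt0// mulr_gt0.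
have den0 : 0 < 8 * dR * nd by rewrite !mulr_gt0.
(* l minimizes 2 d N^d * 2 l^2 - l r *)
pose l := r / (8 * dR * nd); have l0 : 0 <= l by rewrite ltW// divr_gt0.
have := bounded_differences_upper_tail inda aD bbad locbad diffbad r l0.
rewrite expr1n mulr1 => tail; apply: (@le_trans _ _ (P [set w |
    (r <= bad (Xs w) - \int[P]_w bad (Xs w))%R])).
  apply: le_measure.
  - rewrite inE; have [mg _] := bgains.
    have := mg measurableT _ (measurable_itv `]s, +oo[); rewrite setTI.
    by rewrite set_itvE.
  - rewrite inE -[X in measurable X]setTI; apply: measurable_fun_le => //.
    have bc : bmeas (fun _ : T => \int[P]_w bad (Xs w)) by exact: bmeas_cst.
    by case: (bmeasB bbadX bc).
  - move=> w /= sw; rewrite /r ler_pdivrMr; last by rewrite mulr_gt0.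
    have := mean_bound; rewrite -/c; have := gains_le w; rewrite -/c.
    move: s0s sw; set A := C0 * (D0 + 1) * W.
    have -> : s0 = 2 * A by rewrite /A; ring.
    move=> s0s' sw' gle mle; exact: centered_excess s0s' sw' gle mle.
apply: (le_trans tail); rewrite lee_fin ler_expR.
have m2 : (size E)%:R * (2 * l ^+ 2) <= 2 * dR * nd * (2 * l ^+ 2).
  by rewrite ler_wpM2r// mulr_ge0// sqr_ge0.
have e1 : 2 * dR * nd * (2 * l ^+ 2) - l * r = - (r ^+ 2 / (16 * dR * nd)).
  by rewrite /l; field; rewrite !gt_eqF.
apply: (@le_trans _ _ (- (r ^+ 2 / (16 * dR * nd)))); first by rewrite -e1 lerD2r.
have e2 : r ^+ 2 / (16 * dR * nd) = s ^+ 2 * nd ^+ 3 / (128 ^+ 2 * n ^+ 8) / (dR * kappa ^+ 4).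
  by rewrite /r /c; field; rewrite !gt_eqF.
have e3 : C2 * s ^+ 2 = s ^+ 2 * nd ^+ 3 / (128 ^+ 2 * n ^+ 8) / (dR ^+ 2 * kappa ^+ 6).
  by field; rewrite !gt_eqF.
rewrite mulNr lerN2 e2 e3 ler_wpM2l//.
  by rewrite !mulr_ge0 ?invr_ge0 ?mulr_ge0 ?exprn_ge0 ?sqr_ge0// ltW.
rewrite lef_pV2 ?posrE ?mulr_gt0 ?exprn_gt0//.
apply: ler_pM; rewrite ?exprn_ge0 ?(ltW d0) ?(ltW kappa0)//.
  by rewrite expr2 ler_peMl// ltW.
by rewrite ler_weXn2l.
Qed.

(** The martingale inequality with [C1 = 1].  The hypothesis relating [G] and [N]
    says that [s0^2 * C2 >= 1/4], which keeps the prefactor below [11], and the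
    bound on [t^2] is [t^2 <= s0^5 * C2^2], so that the cube root in the exponent
    is at most [s0^(1/2)]; [q] is the power of [N] in the exponent. *)
Lemma kesten_eff_cond (c1 c2 t q : R) : 0 < c1 -> 0 < c2 ->
  kesten_inequality c1 c2 -> (3 <= d)%N -> n ^+ 4 <= G ^+ 2 * nd ->
  0 < t -> t ^+ 2 <= C0 * (D0 + 1) ^+ 5 / 8 * (nd * G ^+ 5 / n ^+ 6) ->
  0 < q -> q ^+ 2 = nd / (n ^+ 2 * G) ->
  (P [set w | (t < `|f w - fine 'E_P[f]|)%R] <=
   (11 * c1 * expR (- (c2 / (2 * Num.sqrt (2 * C0 * (D0 + 1))) * q * t)))%:E)%E.
Proof.
move=> c10 c20 kes d3 nG t0 tle q0 q2; rewrite EfE.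
under eq_set do rewrite fE.
have C2_gt0 : 0 < C2 by rewrite divr_gt0 ?exprn_gt0// !mulr_gt0 ?exprn_gt0.
have B0 : 0 <= B by rewrite divr_ge0 ?mulr_ge0 ?exprn_ge0 ?ltW.
have B2 : expR 2 * B ^+ 2 <= s0.
  apply: (@le_trans _ _ (12 * B ^+ 2)).
    by rewrite ler_wpM2r ?sqr_ge0// expR2_le12.
  have -> : 12 * B ^+ 2 = 64 * (kappa ^+ 2 * n ^+ 2 / nd ^+ 2) * (3 * n ^+ 2).
    by field; rewrite gt_eqF.
  have -> : s0 = 64 * (kappa ^+ 2 * n ^+ 2 / nd ^+ 2) * (dR * nd * (kappa * (D0 + 1) * G)).
    by field; rewrite gt_eqF.
  rewrite ler_wpM2l//; first by rewrite !mulr_ge0 ?invr_ge0 ?exprn_ge0 ?ltW.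
  apply: (@le_trans _ _ (dR * nd)).
    by apply: ler_pM; rewrite ?exprn_ge0 ?(ltW n0)// ?ler_nat// ler_weXn2l// ltnW.
  have k1 : 1 <= kappa * (D0 + 1) * G by apply: mulr_ege1 => //; exact: mulr_ege1.
  by rewrite ler_peMr// ltW// mulr_gt0.
have main := kesten_of_coordinates inda aD bPhi locPhi kes kappaD B0 diffPhi
  ltr01 C2_gt0 B2 tail_gains t0.
apply: (le_trans main); rewrite lee_fin.
apply: ler_pM; rewrite ?expR_ge0//.
- rewrite mulr_ge0 ?(ltW c10)// !addr_ge0// divr_ge0// mulr_ge0 ?sqr_ge0//.
  exact: ltW.
- rewrite mulrC ler_pM2r//.
  have e : s0 ^+ 2 * C2 = (D0 + 1) ^+ 2 / 4 * (G ^+ 2 * nd / n ^+ 4).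
    by field; rewrite !gt_eqF.
  have h : 4^-1 <= s0 ^+ 2 * C2.
    rewrite e -[leLHS]mulr1; apply: ler_pM => //.
      by rewrite -[leLHS]mul1r ler_wpM2r// exprn_ege1.
    by rewrite ler_pdivlMr ?exprn_gt0// mul1r.
  have : 1 / (s0 ^+ 2 * C2) <= 4.
    by rewrite ler_pdivrMr ?(lt_le_trans _ h)//; lra.
  set z := 1 / _; lra.
- rewrite ler_expR mulNr lerN2.
  set y := s0 `^ 2^-1; set z := (t / (s0 * C2)) `^ 3^-1.
  have yE : y = Num.sqrt s0 by rewrite /y powR12_sqrt// ltW.
  have y0 : 0 < y by rewrite yE sqrtr_gt0.
  have y2 : y ^+ 2 = s0 by rewrite yE sqr_sqrtr// ltW.
  have sC : 0 < s0 * C2 by exact: mulr_gt0 s0_gt0 C2_gt0.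
  have zy : z <= y.
    have yy : y = (y ^+ 3) `^ 3^-1.
      by rewrite -powR_mulrn ?(ltW y0)// -powRrM mulfV ?powRr1 ?(ltW y0).
    rewrite /z [leRHS]yy; apply: ge0_ler_powR; rewrite ?nnegrE ?exprn_ge0 ?(ltW y0)//.
      by rewrite divr_ge0 ?(ltW t0) ?(ltW sC)//.
    rewrite ler_pdivrMr//.
    rewrite -(ler_pXn2r (n := 2)) ?nnegrE ?(ltW t0)//; last first.
      by rewrite (mulr_ge0 _ (ltW sC))// exprn_ge0// ltW.
    apply: (le_trans tle); rewrite le_eqVlt; apply/orP; left; apply/eqP.
    have -> : (y ^+ 3 * (s0 * C2)) ^+ 2 = (y ^+ 2) ^+ 3 * (s0 * C2) ^+ 2 by ring.
    by rewrite y2; field; rewrite !gt_eqF.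
  have z0 : 0 <= z by exact: powR_ge0.
  set S := Num.sqrt (2 * C0 * (D0 + 1)).
  have S0 : 0 < S by rewrite sqrtr_gt0 !mulr_gt0.
  have yq : y * q = S.
    apply/eqP; rewrite -(eqrXn2 (n := 2)) ?mulr_ge0 ?(ltW y0) ?(ltW q0) ?(ltW S0)//.
    apply/eqP; rewrite exprMn y2 q2 /S sqr_sqrtr; last by rewrite !mulr_ge0 ?ltW.
    by field; rewrite !gt_eqF.
  have -> : c2 / (2 * S) * q * t = c2 * (t / (2 * y)).
    by rewrite -yq; field; rewrite !gt_eqF.
  rewrite ler_wpM2l ?(ltW c20)// ler_wpM2l ?(ltW t0)//.
  have yz_gt0 : 0 < y + z by rewrite ltr_pwDl.
  have yz_le : y + z <= 2 * y by rewrite mulr_natl mulr2n lerD2l.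
  by rewrite lef_pV2 ?posrE// (lt_le_trans yz_gt0).
Qed.

End inverse_tail.
End random_conductances.

Section power_identities.
Context {R : realType}.
Variables (n : R) (d : nat) (gamma : R).
Hypothesis n0 : 0 < n.

Let nE k : n `^ k%:R = n ^+ k. Proof. by rewrite powR_mulrn// ltW. Qed.

Let powRBn r s : n `^ (r - s) = n `^ r / n `^ s.
Proof. by rewrite powRB//; apply/implyP => _; rewrite gt_eqF. Qed.

Let powRDn r s : n `^ (r + s) = n `^ r * n `^ s.
Proof. by rewrite powRD//; apply/implyP => _; rewrite gt_eqF. Qed.

Let sqr_half r : (n `^ (r / 2)) ^+ 2 = n `^ r.
Proof. by rewrite -powR_mulrn ?powR_ge0// -powRrM divfK. Qed.

Lemma powR_4Bd : n `^ (4 - d%:R) = n ^+ 4 / n ^+ d.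
Proof. by rewrite powRBn !nE. Qed.

Lemma sqr_powR_4Bd_half : (n `^ ((4 - d%:R) / 2)) ^+ 2 = n ^+ 4 / n ^+ d.
Proof. by rewrite sqr_half powR_4Bd. Qed.

Lemma powR_2BdDgamma : n `^ (2 - d%:R + gamma) = n `^ gamma * n ^+ 2 / n ^+ d.
Proof. by rewrite powRDn powRBn !nE mulrC mulrA. Qed.

Lemma sqr_powR_dB6D5gamma_half : (n `^ ((d%:R - 6 + 5 * gamma) / 2)) ^+ 2 =
  n ^+ d * (n `^ gamma) ^+ 5 / n ^+ 6.
Proof.
rewrite sqr_half powRDn powRBn !nE (mulrC 5) powRrM powR_mulrn ?powR_ge0//.
by rewrite mulrAC.
Qed.

Lemma sqr_powR_dB2Bgamma_half : (n `^ ((d%:R - 2 - gamma) / 2)) ^+ 2 =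
  n ^+ d / (n ^+ 2 * n `^ gamma).
Proof.
rewrite sqr_half powRBn powRBn !nE; field.
by rewrite !gt_eqF ?powR_gt0.
Qed.

End power_identities.

Theorem theorem3 (R : realType) (d : nat) (hd : (0 < d)%N)
    (disp : measure_display) (T : measurableType disp) (P : probability T R)
    (a : edge d -> {RV P >-> R}) (kappa : R) :
  1 <= kappa ->
  mutual_independence a ->
  identically_distributed a ->
  (forall (e : edge d) (w : T), 0 < a e w <= kappa) ->
  let C0 : R := 32 * d%:R * kappa ^+ 3 in
  let f (N : nat) (w : T) : R := eff_cond hd (fun e => a e w) N in
  [/\ (* (i) *)
      (5 <= d)%N ->
      (forall N : nat, (1 <= N)%N ->
         ('V_P[f N] <= (128 * d%:R * kappa ^+ 2 * N%:R `^ (4 - d%:R))%:E)%E) /\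
      (forall (t : R) (N : nat), 0 < t -> (1 <= N)%N ->
         (P [set w | (t * N%:R `^ ((4 - d%:R) / 2)
                      <= `|f N w - fine 'E_P[f N]|)%R] <=
          (4 * expR (- t / (8 * kappa * Num.sqrt (2 * d%:R))))%:E)%E),
      (* (ii) *)
      forall D0 gamma : R, 0 < gamma < 2 -> inv_tail a D0 gamma ->
      (4 <= d)%N \/ d = 3%N /\ 2^-1 <= gamma < 1 ->
      forall N : nat, (1 <= N)%N ->
        ('V_P[f N] <=
           (16 * C0 * (D0 + 1) * N%:R `^ (2 - d%:R + gamma))%:E)%E /\
        (forall c1 c2 : R, 0 < c1 -> 0 < c2 -> kesten_inequality c1 c2 ->
         forall t : R, 0 < t ->
           t < Num.sqrt (C0 * (D0 + 1) ^+ 5 / 8)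
               * N%:R `^ ((d%:R - 6 + 5 * gamma) / 2) ->
           (P [set w | (t < `|f N w - fine 'E_P[f N]|)%R] <=
            (11 * c1 * expR (- (c2 / (2 * Num.sqrt (2 * C0 * (D0 + 1)))
                               * N%:R `^ ((d%:R - 2 - gamma) / 2) * t)))%:E)%E)
    & (* (iii) *)
      forall D0 gamma : R, 0 < gamma < 2 -> inv_tail a D0 gamma ->
      d = 3%N -> 0 < gamma <= 2^-1 ->
      forall N : nat, (1 <= N)%N ->
        ('V_P[f N] <= (16 * C0 * (D0 + 1) * N%:R `^ (- 2^-1))%:E)%E].
Proof.
move=> kappa1 inda _ aD C0 f.
have kappa0 : 0 < kappa by exact: lt_le_trans kappa1.
have d0 : 0 <= d%:R :> R by [].
have n1 N : (1 <= N)%N -> 1 <= (N%:R : R) by rewrite (ler_nat _ 1).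
have n0 N : (1 <= N)%N -> 0 < (N%:R : R) by rewrite ltr0n.
have variance_tail D0 gamma N : 0 < gamma < 2 -> inv_tail a D0 gamma ->
    (1 <= N)%N ->
    ('V_P[f N] <= (16 * C0 * (D0 + 1) * N%:R `^ (2 - d%:R + gamma))%:E)%E.
  move=> gamma02 tailD0 N1.
  have D0_ge0 : 0 <= D0 by exact: inv_tail_ge0 (0, Ordinal hd) tailD0.
  apply: (le_trans (variance_eff_cond_inv_tail hd kappa1 inda aD N1 gamma02 tailD0)).
  rewrite lee_fin powR_2BdDgamma ?n0// -/C0.
  rewrite ler_wpM2r// ler_wpM2r ?addr_ge0//.
  by rewrite ler_peMl ?ler1n// /C0 !mulr_ge0 ?exprn_ge0// ltW.
split.
- move=> d5; split=> [N N1|t N t0 N1].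
    apply: (le_trans (variance_eff_cond_trivial hd kappa1 inda aD N1)).
    rewrite lee_fin powR_4Bd ?n0// ler_wpM2r ?divr_ge0 ?exprn_ge0//.
    rewrite ler_wpM2r ?exprn_ge0 ?(ltW kappa0)// ler_wpM2r// ler_nat//.
  apply: (tail_eff_cond hd kappa1 inda aD N1 t0).
    by rewrite powR_gt0// n0.
  by rewrite sqr_powR_4Bd_half// n0.
- move=> D0 gamma gamma02 tailD0 hdim N N1; split; first exact: variance_tail.
  move=> c1 c2 c10 c20 kes t t0 tlt.
  have d3 : (3 <= d)%N by case: hdim => [/ltnW//|[-> _]].
  have G1 : 1 <= N%:R `^ gamma :> R.
    have /andP[/ltW g0 _] := gamma02.
    by have := ler_powR (n1 _ N1) g0; rewrite powRr0.
  apply: (kesten_eff_cond hd kappa1 inda aD N1 gamma02 tailD0 c10 c20 kes d3) => //.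
  + case: hdim => [d4|[dE /andP[gamma12 _]]].
      rewrite -[leLHS]mul1r; apply: ler_pM; rewrite ?exprn_ge0 ?exprn_ege1//.
      by rewrite ler_weXn2l// n1.
    rewrite dE exprS ler_wpM2r ?exprn_ge0//.
    rewrite -powR_mulrn ?powR_ge0// -powRrM -[leLHS]powRr1//.
    by apply: ler_powR; [exact: n1|lra].
  + have A0 : 0 <= C0 * (D0 + 1) ^+ 5 / 8.
      rewrite divr_ge0// mulr_ge0 ?exprn_ge0//.
        by rewrite /C0 !mulr_ge0 ?exprn_ge0// ltW.
      by rewrite addr_ge0// (inv_tail_ge0 (0, Ordinal hd) tailD0).
    rewrite -sqr_powR_dB6D5gamma_half ?n0// -[X in X * _](sqr_sqrtr A0) -exprMn.
    by rewrite lerXn2r ?nnegrE ?(ltW t0) ?mulr_ge0 ?sqrtr_ge0 ?powR_ge0// ltW.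
  + by rewrite powR_gt0// n0.
  + by rewrite sqr_powR_dB2Bgamma_half// n0.
- move=> D0 gamma gamma02 tailD0 d3 /andP[_ gamma12] N N1.
  apply: (le_trans (variance_tail D0 gamma N gamma02 tailD0 N1)).
  have D0_ge0 : 0 <= D0 by exact: inv_tail_ge0 (0, Ordinal hd) tailD0.
  rewrite lee_fin ler_wpM2l//.
    by rewrite mulr_ge0 ?addr_ge0// /C0 !mulr_ge0 ?exprn_ge0// ltW.
  by apply: ler_powR; [exact: n1|rewrite d3; lra].
Qed.
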